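(* Let $\mathcal W$ be a measure matrix, $Q(x)=\prod_{i=1}^s(x-q_i)^{n_i}=Q_0+Q_1x+\dots+Q_{N-1}x^{N-1}+x^N$ with $\{q_i\}\cap\Omega=\varnothing$, and let $\check{\mathcal W}_L,\check{\mathcal W}_R$ be the Geronimus–Sobolev deformed measure matrices. Assume that $G_{\mathcal W},G_{\check{\mathcal W}_L},G_{\check{\mathcal W}_R}$ are $LU$-factorizable. Then the deformed polynomials and second kind functions are related to the original ones by $$\check\omega_LP_2(x)=\check P_{2L}(x),\qquad \check\omega_LC_2(x)=Q(x)\check C_{2L}(x)-\check H_L(\check S_{1L}^{-1})^\top\mathbf Q\,\chi(x),$$ $$\check\omega_RP_1(x)=\check P_{1R}(x),\qquad \check\omega_RC_1(x)=Q(x)\check C_{1R}(x)-\check H_R(\check S_{2R}^{-1})^\top\mathbf Q\,\chi(x),$$ (the identities for the second kind functions holding for $x\notin\Omega\cup\{q_i\}_i$).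
   Context: Semi-infinite matrices and vectors are indexed from $0$; $A^{[k]}$ is the leading $k\times k$ truncation. A measure matrix of order $\mathcal N$ is a semi-infinite matrix $\mathcal W=(d\mu_{i,j})$ of (possibly signed) Borel measures with (closed) supports $\Omega_{i,j}\subseteq\mathbb R$, zero if $i>\mathcal N$ or $j>\mathcal N$; $\Omega=\bigcup\Omega_{i,j}$; $(f,h;\mathcal W)=\sum_{n,r}\int_{\Omega_{n,r}}f^{(n)}h^{(r)}d\mu_{n,r}$ (finite on polynomials); $(G_{\mathcal W})_{n,p}=(x^n,x^p;\mathcal W)$. A matrix $G$ is $LU$-factorizable if $\det G^{[k]}\neq0$ for all $k\ge1$; then uniquely $G=S_1^{-1}H(S_2^{-1})^\top$ with $S_1,S_2$ lower unitriangular, $H=\mathrm{diag}(h_0,h_1,\dots)$; $P_\alpha(x)=S_\alpha\chi(x)$, $\chi(x)=(1,x,x^2,\dots)^\top$. Second kind functions: $C_{1,l}(y)=(P_{1,l}(x),\tfrac1{y-x};\mathcal W)$, $C_{2,l}(y)=(\tfrac1{y-x},P_{2,l}(x);\mathcal W)$, for $y\notin\Omega$ (pairings in the variable $x$, assumed defined); $C_\alpha=(C_{\alpha,0},C_{\alpha,1},\dots)^\top$. $\mathcal X$ is the semi-infinite upper bidiagonal matrix with $\mathcal X_{n,n}=x$, $\mathcal X_{n,n+1}=n+1$; $Q(\mathcal X)$ is upper triangular with entries $Q(\mathcal X)_{n,n+i}=\binom{n+i}{i}Q^{(i)}(x)$, invertible on $\Omega$. Geronimus–Sobolev deformations: $\check{\mathcal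 W}_L:=[Q(\mathcal X)]^{-1}\mathcal W+\sum_{i=1}^s\xi^{(i)}\delta(x-q_i)dx$, $\check{\mathcal W}_R:=\mathcal W[Q(\mathcal X^\top)]^{-1}+\sum_{i=1}^s\xi^{(i)}\delta(x-q_i)dx$, supported on $\Omega\cup\{q_i\}$, where $\xi^{(i)}$ is an $n_i\times n_i$ matrix of free real parameters placed in rows and columns $0,\dots,n_i-1$. One has $G_{\mathcal W}=Q(\Lambda)G_{\check{\mathcal W}_L}=G_{\check{\mathcal W}_R}Q(\Lambda)^\top$, with $\Lambda_{i,j}=\delta_{i+1,j}$. Objects associated with $\check{\mathcal W}_L$ (resp. $\check{\mathcal W}_R$) carry a check and index $L$ (resp. $R$): $\check S_{\alpha L},\check H_L,\check P_{\alpha L},\check C_{\alpha L}$, etc. Resolvents: $\check\omega_L:=\check H_L(\check S_{1L}^{-1})^\top Q(\Lambda^\top)S_1^\top H^{-1}=\check S_{2L}S_2^{-1}$, $\check\omega_R:=\check H_R(\check S_{2R}^{-1})^\top Q(\Lambda^\top)S_2^\top H^{-1}=\check S_{1R}S_1^{-1}$. $\mathbf Q$ is the semi-infinite Hankel matrix $\mathbf Q_{i,j}=Q_{i+j+1}$ with $Q_N=1$ and $Q_l=0$ for $l>N$. *)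

(* Defs.v *)
From HB Require Import structures.
From mathcomp Require Import all_boot all_order all_algebra.
From mathcomp Require Import all_classical all_reals all_analysis.
From mathcomp Require Import complex zify.

Set Implicit Arguments.
Unset Strict Implicit.
Unset Printing Implicit Defensive.

Import Order.TTheory GRing.Theory Num.Theory.
Import numFieldNormedType.Exports.

Local Open Scope classical_set_scope.
Local Open Scope ring_scope.

Notation smatrix T := (nat -> nat -> T).

Section SemiInfinite.
Variable T : pzRingType.
Implicit Types (A B : smatrix T) (v : nat -> T).

(* The sums over all of nat are finitely supported sums: such a product is
   meaningful when each of them has finitely many nonzero terms. *)
Definition smul A B : smatrix T :=
  fun i j => \sum_(k \in [set: nat]) A i k * B k j.

Definition smulv A v : nat -> T :=
  fun i => \sum_(k \in [set: nat]) A i k * v k.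

Definition str A : smatrix T := fun i j => A j i.

Definition sdiag v : smatrix T := fun i j => if i == j then v i else 0.

Definition sexp A (k : nat) : smatrix T := iter k (smul A) (sdiag (fun=> 1)).

Definition trunc (k : nat) A : 'M[T]_k := \matrix_(i < k, j < k) A i j.

Definition schi (x : T) : nat -> T := fun n => x ^+ n.

Definition shift : smatrix T := fun i j => (j == i.+1)%:R.

Definition lower_unitriangular A : Prop :=
  (forall i, A i i = 1) /\ (forall i j, (i < j)%N -> A i j = 0).

End SemiInfinite.

Arguments shift {T}.

Definition smap (T U : Type) (f : T -> U) (A : smatrix T) : smatrix U :=
  fun i j => f (A i j).

Definition speval (T : nzRingType) (p : {poly T}) (A : smatrix T) : smatrix T :=
  fun i j => \sum_(k < size p) p`_k * sexp A k i j.

(* Inverse of a lower (or upper) triangular matrix with invertible diagonal.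
   For such a matrix the leading blocks of the inverse are the inverses of the
   leading blocks, so any block containing the position (i, j) may be used. *)
Definition sinv (T : comUnitRingType) (A : smatrix T) : smatrix T :=
  fun i j => invmx (trunc (maxn i j).+1 A) (inord i) (inord j).

Lemma smul_bound (T : pzRingType) (A B : smatrix T) i j (N : nat) :
  (forall k, (N <= k)%N -> A i k * B k j = 0) ->
  smul A B i j = \sum_(k < N) A i k * B k j.
Proof.
move=> AB0; rewrite /smul -(fsbig_widen (`I_N)) //; last first.
  move=> k /= [_ /negP]; rewrite -leqNgt; exact: AB0.
by rewrite -fsbig_ord.
Qed.

Section LU.
Variable F : fieldType.
Implicit Types (G S : smatrix F) (h : nat -> F).

Definition LU_factorizable G : Prop :=
  forall k, (0 < k)%N -> \det (trunc k G) != 0.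

Definition is_LU G (S1 : smatrix F) h (S2 : smatrix F) : Prop :=
  [/\ lower_unitriangular S1, lower_unitriangular S2 &
      G = smul (smul (sinv S1) (sdiag h)) (str (sinv S2))].

Definition Ppoly (S : smatrix F) : nat -> {poly F} :=
  smulv (smap polyC S) (schi 'X).

Definition resolvent (Q : {poly F}) (h' : nat -> F) (S1' S1 : smatrix F)
    (h : nat -> F) : smatrix F :=
  smul (smul (smul (smul (sdiag h') (str (sinv S1')))
                   (speval Q (str shift)))
             (str S1))
       (sdiag (fun k => (h k)^-1)).

Definition Qhankel (Q : {poly F}) : smatrix F := fun i j => Q`_(i + j).+1.

End LU.

Section SignedMeasure.
Variable R : realType.

Local Notation borel_charge := (charge (measurableTypeR R) R).
Implicit Types (nu : borel_charge) (D : set R) (f : R -> R).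

Definition csupport nu : set R :=
  ~` \bigcup_(U in [set U : set R | open U /\
        forall A : set (measurableTypeR R), measurable A -> A `<=` U ->
          nu A = 0%E]) U.

Definition hahn_pos nu := proj1_sig (cid (Hahn_decomposition nu)).

Definition hahn_neg nu :=
  proj1_sig (cid (proj2_sig (cid (Hahn_decomposition nu)))).

Definition hahn_spec nu :
    hahn_decomposition nu (hahn_pos nu) (hahn_neg nu) :=
  proj2_sig (cid (proj2_sig (cid (Hahn_decomposition nu)))).

Definition cpos nu : {measure set (measurableTypeR R) -> \bar R} :=
  jordan_pos (hahn_spec nu).

Definition cneg nu : {measure set (measurableTypeR R) -> \bar R} :=
  jordan_neg (hahn_spec nu).

Definition cintegrable nu D f : Prop :=
  (cpos nu).-integrable D (EFin \o f) /\ (cneg nu).-integrable D (EFin \o f).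

Definition cintegral nu D f : R :=
  Rintegral (cpos nu) D f - Rintegral (cneg nu) D f.

(* A signed measure which is finite on polynomials is finite, whence the use of
   charges, which only take finite values. *)
Record measure_matrix := MeasureMatrix {
  morder : nat ;
  mentry :> nat -> nat -> borel_charge ;
  mentry_eq0 : forall i j, (morder < i)%N \/ (morder < j)%N ->
    forall A : set (measurableTypeR R), measurable A -> mentry i j A = 0%E ;
  mentry_poly : forall i j (p : {poly R}),
    cintegrable (mentry i j) (csupport (mentry i j)) (horner p) }.

Implicit Types W : measure_matrix.

Definition Omega W : set R :=
  \bigcup_(ij in [set: nat * nat]) csupport (W ij.1 ij.2).

Definition pairing W (f h : R -> R) : R :=
  \sum_(n < (morder W).+1) \sum_(r < (morder W).+1)
    cintegral (W n r) (csupport (W n r))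
      (fun x => derive1n n f x * derive1n r h x).

Definition gram W : smatrix R :=
  fun n p => pairing W (fun x => x ^+ n) (fun x => x ^+ p).

(* Complex-bilinear extension of the form to complex-valued functions of a real
   variable (derivatives and integrals are taken componentwise). *)
Definition cpairing W (f h : R -> R[i]) : R[i] :=
  let fr x := complex.Re (f x) in let fi x := complex.Im (f x) in
  let hr x := complex.Re (h x) in let hi x := complex.Im (h x) in
  ((pairing W fr hr - pairing W fi hi)
    +i* (pairing W fr hi + pairing W fi hr))%C.

Definition second_kind1 W (S1 : smatrix R) (y : R[i]) : nat -> R[i] :=
  fun l => cpairing W (fun x => ((Ppoly S1 l).[x])%:C%C)
                      (fun x => (y - x%:C%C)^-1).

Definition second_kind2 W (S2 : smatrix R) (y : R[i]) : nat -> R[i] :=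
  fun l => cpairing W (fun x => (y - x%:C%C)^-1)
                      (fun x => ((Ppoly S2 l).[x])%:C%C).

Definition calX (x : R) : smatrix R :=
  fun n m => if m == n then x else if m == n.+1 then n.+1%:R else 0.

Lemma sexp_calX (x : R) k n m : sexp (calX x) k n m =
  if (n <= m)%N then (('X^k)^`(m - n)).[x] *+ 'C(m, n) else 0.
Proof.
elim: k n m => [|k IH] n m.
  rewrite /sexp /= /sdiag expr0; case: (ltngtP n m) => [nm|nm|->].
  - rewrite -[1]/(1%:P) -[(m - n)%N]prednK ?subn_gt0// derivSn derivC linear0.
    by rewrite horner0 mul0rn.
  - by [].
  - by rewrite subnn derivn0 hornerC binn.
rewrite -[LHS]/(smul (calX x) (sexp (calX x) k) n m).
rewrite (@smul_bound _ _ _ _ _ n.+2); last first.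
  move=> l nl; rewrite /calX !gtn_eqF ?mul0r//; exact: ltnW.
rewrite !big_ord_recr /= big1 ?add0r; last first.
  move=> [l ln] _ /=; rewrite /calX !ltn_eqF ?mul0r//; exact: ltnW.
rewrite /calX eqxx gtn_eqF// eqxx !IH.
rewrite exprSr.
case: (ltngtP n m) => [nm|nm|<-].
- have [d md] : exists d, m = (n + d.+1)%N by exists (m - n.+1)%N; lia.
  rewrite md addKn (_ : n + d.+1 - n.+1 = d)%N; last by lia.
  rewrite (_ : 'X^k * 'X = 'X^k * 'X + 0%:P :> {poly R}); last by rewrite addr0.
  rewrite derivnMXaddC hornerD hornerMn hornerM hornerX.
  rewrite mulrnDl -mulrnA [RHS]addrC mulrnAr [x * _]mulrC; congr (_ + _).
  rewrite mulr_natl -mulrnA; congr (_ *+ _).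
  by have := mul_bin_left (n + d.+1) n; rewrite addKn mulnC [in RHS]mulnC.
- by rewrite ?mulr0 ?add0r.
by rewrite subnn !derivn0 mulr0 addr0 binn !hornerE mulrC.
Qed.

Lemma speval_calX (p : {poly R}) x n m : speval p (calX x) n m =
  if (n <= m)%N then p^`(m - n).[x] *+ 'C(m, n) else 0.
Proof.
rewrite /speval; under eq_bigr do rewrite sexp_calX.
case: ifP => nm; last by rewrite big1// => i _; rewrite mulr0.
have -> : p^`(m - n) = \sum_(i < size p) (p`_i *: 'X^i)^`(m - n).
  by rewrite -[LHS]/(derivn _ p) -[p in LHS]coefK poly_def linear_sum.
rewrite horner_sum -sumrMnl.
by apply: eq_bigr => i _; rewrite derivnZ hornerZ mulrnAr.
Qed.

Definition geronimus_poly (s : nat) (q : 'I_s -> R) (n : 'I_s -> nat) :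
    {poly R} :=
  \prod_(l < s) ('X - (q l)%:P) ^+ n l.

(* The n x n matrix xi placed in rows and columns 0, ..., n-1. *)
Definition pad (n : nat) (xi : 'M[R]_n) : smatrix R :=
  fun i j => \sum_(a < n | a == i :> nat) \sum_(b < n | b == j :> nat) xi a b.

Definition point_masses (s : nat) (q : 'I_s -> R) (n : 'I_s -> nat)
    (xi : forall l : 'I_s, 'M[R]_(n l)) (i j : nat)
    (A : set (measurableTypeR R)) : \bar R :=
  (\sum_(l < s) (pad (xi l) i j)%:E * dirac (q l : measurableTypeR R) A)%E.

(* The entries of Q(calX)^-1 W are the measures with the indicated densities:
   their value on a Borel set A is the integral of the density over A. *)
Definition geronimus_left W (s : nat) (q : 'I_s -> R) (n : 'I_s -> nat)
    (xi : forall l : 'I_s, 'M[R]_(n l)) (WL : measure_matrix) : Prop :=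
  forall i j (A : set (measurableTypeR R)), measurable A ->
    WL i j A =
    ((\sum_(k < (morder W).+1) cintegral (W k j) A
        (fun x => sinv (speval (geronimus_poly q n) (calX x)) i k))%:E
     + point_masses q xi i j A)%E.

Definition geronimus_right W (s : nat) (q : 'I_s -> R) (n : 'I_s -> nat)
    (xi : forall l : 'I_s, 'M[R]_(n l)) (WR : measure_matrix) : Prop :=
  forall i j (A : set (measurableTypeR R)), measurable A ->
    WR i j A =
    ((\sum_(k < (morder W).+1) cintegral (W i k) A
        (fun x => sinv (speval (geronimus_poly q n) (str (calX x))) k j))%:E
     + point_masses q xi i j A)%E.

End SignedMeasure.

(* Main.v *)
Require Import Defs.
From HB Require Import structures.
From mathcomp Require Import all_boot all_order all_algebra.
From mathcomp Require Import all_classical all_reals all_analysis.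
From mathcomp Require Import complex.
From mathcomp Require Import measurable_realfun ring lra zify.

(** Everything follows from one identity: multiplication by [Q] undoes the
    deformation.  For [f] and [h] smooth near the supports and the points [q_l],
    [(Q f, h; WL) = (f, h; W)] (lemma [pairing_geronimus]).  Indeed, by Leibniz's
    rule the row of derivatives of [Q f] is the row of derivatives of [f] times
    [Q(calX)], which cancels the density [Q(calX)^-1] of the deformed matrix, and
    this row vanishes at [q_l] up to the order of the zero, which kills the point
    masses.

    Applied to monomials, the identity reads [G_W = Q(shift) G_WL]; comparing the
    two triangular factorizations gives [omegaL = S2L S2^-1] (lemma
    [resolventE]), whence the connection formula for the polynomials.

    Applied to the Cauchy kernel [1 / (y - x)], it gives, by linearity,
    [(omegaL C2)_l = (1 / (y - x), P2L_l; W) = (Q(x) / (y - x), P2L_l; WL)].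
    Since [Q(y) - Q(x)] is [y - x] times the polynomial with coefficients
    [Q_(i+j+1)] (lemma [horner_divided_difference]), the last pairing is
    [Q(y) C2L_l] minus a combination of the moments [(x^i, P2L_l; WL)].  These
    are the entries of [S2L G_WL^T = hL S1L^-T], which produces the Hankel
    correction.

    The right-hand formulas are the left-hand ones for the transposed measure
    matrices (definition [mtr]).

    The analytic work is of two kinds.  The deformed entries are known only
    through their values on Borel sets, and the corresponding formula for
    integrals of unbounded functions comes from simple functions by dominated
    convergence (lemmas [dominated_continuous_unique] and [cintegral_density]).
    Integrability is never an issue, because every integrand that occurs is
    dominated by a polynomial on the supports: all of them are built from
    rational functions whose denominators stay away from zero there. *)

Set Implicit Arguments.
Unset Strict Implicit.
Unset Printing Implicit Defensive.

Import Order.TTheory GRing.Theory Num.Theory.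
Import numFieldNormedType.Exports.

Local Open Scope classical_set_scope.
Local Open Scope ring_scope.

(** * Semi-infinite matrices *)

Section RowFinite.
Variable T : comNzRingType.
Implicit Types (A B C : smatrix T) (v : nat -> T).

Definition row_finite A : Prop :=
  forall i, exists N, forall k, (N <= k)%N -> A i k = 0.

Lemma row_finite_uniform A (M : nat) : row_finite A ->
  exists N, forall i k, (i < M)%N -> (N <= k)%N -> A i k = 0.
Proof.
move=> rA; elim: M => [|M [N HN]]; first by exists 0%N.
have [N' HN'] := rA M; exists (maxn N N') => i k.
rewrite ltnS leq_eqVlt geq_max => /predU1P[->|iM] /andP[Nk N'k]; first exact: HN'.
exact: HN.
Qed.

Lemma smulr_bound A B i j N :
  (forall k, (N <= k)%N -> A i k = 0) ->
  smul A B i j = \sum_(k < N) A i k * B k j.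
Proof. by move=> H; apply: smul_bound => k /H ->; rewrite mul0r. Qed.

Lemma smull_bound A B i j N :
  (forall k, (N <= k)%N -> B k j = 0) ->
  smul A B i j = \sum_(k < N) A i k * B k j.
Proof. by move=> H; apply: smul_bound => k /H ->; rewrite mulr0. Qed.

Lemma str_smul A B : str (smul A B) = smul (str B) (str A).
Proof.
apply/funext => i; apply/funext => j; rewrite /str /smul.
by apply: eq_fsbigr => k _; rewrite mulrC.
Qed.

Lemma smulv_smul A v i j : smulv A v i = smul A (fun k _ => v k) i j.
Proof. by []. Qed.

Lemma smulv_bound A v i N :
  (forall k, (N <= k)%N -> A i k = 0) -> smulv A v i = \sum_(k < N) A i k * v k.
Proof. by move=> AN; rewrite (smulv_smul _ _ _ 0%N) (smulr_bound _ _ AN). Qed.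

Lemma row_finite_smul A B : row_finite A -> row_finite B ->
  row_finite (smul A B).
Proof.
move=> rA rB i; have [N HN] := rA i.
have [M HM] := row_finite_uniform N rB.
exists M => k Mk; rewrite (smulr_bound _ _ HN) big1// => l _.
by rewrite HM ?mulr0.
Qed.

(** Products of semi-infinite matrices associate only when the double sums are
    finite.  Two shapes occur: the two left factors have finite rows, or else
    the left factor has finite rows and the right one finite columns. *)
Lemma smulA_rr A B C : row_finite A -> row_finite B ->
  smul A (smul B C) = smul (smul A B) C.
Proof.
move=> rA rB; apply/funext => i; apply/funext => j; have [N HN] := rA i.
have [M HM] := row_finite_uniform N rB.
rewrite (smulr_bound _ _ HN).
rewrite (@smulr_bound _ _ _ _ M); last first.
  by move=> k Mk; rewrite (smulr_bound _ _ HN) big1// => l _; rewrite HM ?mulr0.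
under [RHS]eq_bigr => k _ do rewrite (smulr_bound _ _ HN) mulr_suml.
rewrite exchange_big /=; apply: eq_bigr => l _.
rewrite (@smulr_bound _ _ _ _ M); last by move=> k; exact: HM.
by rewrite mulr_sumr; apply: eq_bigr => k _; rewrite mulrA.
Qed.

Lemma smulA_rc A B C : row_finite A -> row_finite (str C) ->
  smul A (smul B C) = smul (smul A B) C.
Proof.
move=> rA rC; apply/funext => i; apply/funext => j; have [N HN] := rA i.
have [M HM] := rC j.
rewrite (smulr_bound _ _ HN) (smull_bound _ _ HM).
under [RHS]eq_bigr => k _ do rewrite (smulr_bound _ _ HN) mulr_suml.
rewrite exchange_big /=; apply: eq_bigr => l _.
rewrite (smull_bound _ _ HM).
by rewrite mulr_sumr; apply: eq_bigr => k _; rewrite mulrA.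
Qed.

Lemma smulvA A B v : row_finite A -> row_finite B ->
  smulv A (smulv B v) = smulv (smul A B) v.
Proof.
move=> rA rB; apply/funext => i.
by rewrite !(smulv_smul _ _ _ 0%N) -smulA_rr.
Qed.

Lemma row_finite_diag v : row_finite (sdiag v).
Proof. by move=> i; exists i.+1 => k ik; rewrite /sdiag ltn_eqF. Qed.

Lemma str_diag v : str (sdiag v) = sdiag v.
Proof.
apply/funext => i; apply/funext => j; rewrite /str /sdiag eq_sym.
by case: eqP => // ->.
Qed.

Lemma smul_diagl v A i j : smul (sdiag v) A i j = v i * A i j.
Proof.
rewrite (@smulr_bound _ _ _ _ i.+1); last first.
  by move=> k ik; rewrite /sdiag ltn_eqF.
rewrite big_ord_recr /= big1 ?add0r ?/sdiag ?eqxx// => k _.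
by rewrite gtn_eqF ?mul0r.
Qed.

Lemma smul_diagr v A i j : smul A (sdiag v) i j = A i j * v j.
Proof.
have /(congr1 (fun M => M j i)) := str_smul A (sdiag v).
by rewrite str_diag smul_diagl mulrC.
Qed.

Lemma sdiag1E i j : sdiag (fun=> 1) i j = (i == j)%:R :> T.
Proof. by rewrite /sdiag; case: eqP. Qed.

Lemma smul1s A : smul (sdiag (fun=> 1)) A = A.
Proof. by apply/funext => i; apply/funext => j; rewrite smul_diagl mul1r. Qed.

Lemma smuls1 A : smul A (sdiag (fun=> 1)) = A.
Proof. by apply/funext => i; apply/funext => j; rewrite smul_diagr mulr1. Qed.

Lemma row_finite_sexp A k : row_finite A -> row_finite (sexp A k).
Proof.
move=> rA; elim: k => [|k IH]; first exact: row_finite_diag.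
exact: row_finite_smul.
Qed.

Lemma sexpSr A k : row_finite A -> sexp A k.+1 = smul (sexp A k) A.
Proof.
move=> rA; elim: k => [|k IH]; first by rewrite /sexp /= smuls1 smul1s.
rewrite -[LHS]/(smul A (sexp A k.+1)) {1}IH smulA_rr//.
exact: row_finite_sexp.
Qed.

(** Transposition reverses products, so powers of [A] have to be unfolded from
    both ends. *)
Lemma str_sexp A k : row_finite A -> sexp (str A) k = str (sexp A k).
Proof.
move=> rA; elim: k => [|k IH]; first by rewrite /sexp /= str_diag.
by rewrite (sexpSr k rA) str_smul -IH.
Qed.

Lemma str_speval (p : {poly T}) A : row_finite A ->
  speval p (str A) = str (speval p A).
Proof.
move=> rA; apply/funext => i; apply/funext => j.
by rewrite /speval /str; apply: eq_bigr => k _; rewrite str_sexp.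
Qed.

Lemma sexp_str_shift k i j :
  sexp (str (@Defs.shift T)) k i j = (i == j + k)%N%:R.
Proof.
elim: k i j => [|k IH] i j.
  by rewrite /sexp /sdiag /= addn0; case: eqP.
rewrite -[LHS]/(smul (str Defs.shift) (sexp (str Defs.shift) k) i j).
rewrite (@smulr_bound _ _ _ _ i); last first.
  by move=> l il; rewrite /str /Defs.shift ltn_eqF.
case: i => [|i]; first by rewrite big_ord0 addnS.
rewrite big_ord_recr /= big1 ?add0r; last first.
  by move=> l _; rewrite /str /Defs.shift eqSS gtn_eqF ?mul0r.
by rewrite /str /Defs.shift eqxx mul1r IH addnS eqSS.
Qed.

Lemma speval_str_shift (p : {poly T}) i j :
  speval p (str Defs.shift) i j = if (j <= i)%N then p`_(i - j) else 0.
Proof.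
rewrite /speval; under eq_bigr do rewrite sexp_str_shift.
case: leqP => ij; last first.
  rewrite big1// => k _; rewrite ltn_eqF ?mulr0//.
  by rewrite (leq_trans ij)// leq_addr.
have [pij|ijp] := leqP (size p) (i - j).
  rewrite nth_default// big1// => k _; rewrite gtn_eqF ?mulr0//.
  by rewrite -ltn_subRL (leq_trans _ pij).
rewrite (bigD1 (Ordinal ijp))//= subnKC// eqxx mulr1 big1 ?addr0// => k kij.
rewrite (_ : (i == _) = false) ?mulr0//; apply/negbTE; apply: contra kij.
by move=> /eqP ikj; rewrite -val_eqE /= [X in (X - j)%N]ikj addKn.
Qed.

Lemma row_finite_speval_shift (p : {poly T}) :
  row_finite (str (speval p (str Defs.shift))).
Proof.
move=> j; exists (size p + j)%N => i pij; rewrite /str speval_str_shift.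
by case: ifP => // ji; rewrite nth_default// leq_subRL// addnC.
Qed.

End RowFinite.

Lemma row_finite_smap (T U : comNzRingType) (f : {rmorphism T -> U})
  (A : smatrix T) : row_finite A -> row_finite (smap f A).
Proof.
by move=> rA i; have [N HN] := rA i; exists N => k /HN; rewrite /smap => ->; rewrite rmorph0.
Qed.

Lemma smap_smul (T U : comNzRingType) (f : {rmorphism T -> U})
    (A B : smatrix T) : row_finite A ->
  smap f (smul A B) = smul (smap f A) (smap f B).
Proof.
move=> rA; apply/funext => i; apply/funext => j; have [N HN] := rA i.
rewrite /smap (smulr_bound _ _ HN) (@smulr_bound _ _ _ _ _ N); last first.
  by move=> k /HN ->; rewrite rmorph0.
by rewrite rmorph_sum; apply: eq_bigr => k _; rewrite rmorphM.
Qed.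

Section Triangular.
Variable F : fieldType.
Implicit Types (A B S G : smatrix F) (h : nat -> F).

Lemma sinv_str A : sinv (str A) = str (sinv A).
Proof.
apply/funext => i; apply/funext => j; rewrite /sinv /str maxnC.
have -> : trunc (maxn j i).+1 (fun i0 j0 => A j0 i0) = (trunc (maxn j i).+1 A)^T.
  by apply/matrixP => a b; rewrite !mxE.
by rewrite -trmx_inv mxE.
Qed.

Definition lower_triangular A : Prop := forall i j, (i < j)%N -> A i j = 0.

Lemma row_finite_lower A : lower_triangular A -> row_finite A.
Proof. by move=> lA i; exists i.+1 => k; exact: lA. Qed.

Lemma trunc_unit A m : lower_triangular A -> (forall i, A i i != 0) ->
  trunc m A \in unitmx.
Proof.
move=> lA dA; rewrite unitmxE det_trig.
  by rewrite unitfE; apply/prodf_neq0 => i _; rewrite mxE.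
by apply/is_trig_mxP => i j ij; rewrite mxE lA.
Qed.

(** The leading blocks of the inverse of a lower triangular block are the
    inverses of its leading blocks, since the first rows vanish outside the
    leading block. *)
Lemma sinvE A m i j : lower_triangular A -> (forall i, A i i != 0) ->
  (i < m.+1)%N -> (j < m.+1)%N ->
  sinv A i j = invmx (trunc m.+1 A) (inord i) (inord j).
Proof.
move=> lA dA im jm; rewrite /sinv; set m' := maxn i j.
have m'm : (m'.+1 <= m.+1)%N by rewrite ltnS geq_max -ltnS im.
pose B := \matrix_(a < m'.+1, b < m'.+1)
  invmx (trunc m.+1 A) (widen_ord m'm a) (widen_ord m'm b).
have AB : trunc m'.+1 A *m B = 1%:M.
  apply/matrixP => a b.
  have := congr1 (fun M : 'M[F]_m.+1 => M (widen_ord m'm a) (widen_ord m'm b))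
    (mulmxV (trunc_unit m.+1 lA dA)).
  rewrite !mxE => <-.
  under eq_bigr => k _ do rewrite !mxE -[widen_ord m'm k]inord_val.
  rewrite (big_ord_widen _ (fun k => A a k *
     invmx (trunc m.+1 A) (inord k) (widen_ord m'm b)) m'm) big_mkcond /=.
  apply: eq_bigr => k _; rewrite !mxE inord_val; case: ltnP => // km'.
  by rewrite lA ?mul0r// (leq_trans (ltn_ord a) km').
have -> : invmx (trunc m'.+1 A) = B.
  by rewrite -[RHS](mulKmx (trunc_unit m'.+1 lA dA)) AB mulmx1.
rewrite mxE; congr (invmx _ _ _); apply/val_inj => /=.
  by rewrite !inordK// ltnS leq_maxl.
by rewrite !inordK// ltnS leq_maxr.
Qed.

Lemma smul_sinvr A : lower_triangular A -> (forall i, A i i != 0) ->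
  smul A (sinv A) = sdiag (fun=> 1).
Proof.
move=> lA dA; apply/funext => i; apply/funext => j.
pose m := maxn i j; have im : (i < m.+1)%N by rewrite ltnS leq_maxl.
have jm : (j < m.+1)%N by rewrite ltnS leq_maxr.
rewrite (@smulr_bound _ _ _ _ _ m.+1); last by move=> k mk; rewrite lA// (leq_trans im).
under eq_bigr => k _ do rewrite (sinvE lA dA (ltn_ord k) jm) inord_val.
have := congr1 (fun M : 'M[F]_m.+1 => M (inord i) (inord j))
    (mulmxV (trunc_unit m.+1 lA dA)).
rewrite !mxE -val_eqE /= !inordK// sdiag1E => <-.
by apply: eq_bigr => k _; rewrite !mxE inordK.
Qed.

Lemma lower_triangular_sinv A : lower_triangular A -> (forall i, A i i != 0) ->
  lower_triangular (sinv A).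
Proof.
move=> lA dA i j; elim/ltn_ind: i => i IH ij.
have /(congr1 (fun M => M i j)) := smul_sinvr lA dA.
rewrite /sdiag ltn_eqF// (@smulr_bound _ _ _ _ _ i.+1); last by move=> k /lA.
rewrite big_ord_recr /= big1 ?add0r => [/eqP|k _].
  by rewrite mulf_eq0 (negbTE (dA i)) => /eqP.
by rewrite IH ?mulr0// (ltn_trans _ ij).
Qed.

Lemma smul_sinvl A : lower_triangular A -> (forall i, A i i != 0) ->
  smul (sinv A) A = sdiag (fun=> 1).
Proof.
move=> lA dA; apply/funext => i; apply/funext => j.
pose m := maxn i j; have im : (i < m.+1)%N by rewrite ltnS leq_maxl.
have jm : (j < m.+1)%N by rewrite ltnS leq_maxr.
rewrite (@smulr_bound _ _ _ _ _ m.+1); last first.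
  by move=> k mk; rewrite lower_triangular_sinv// (leq_trans im).
under eq_bigr => k _ do rewrite (sinvE lA dA im (ltn_ord k)) inord_val.
have := congr1 (fun M : 'M[F]_m.+1 => M (inord i) (inord j))
    (mulVmx (trunc_unit m.+1 lA dA)).
rewrite !mxE -val_eqE /= !inordK// sdiag1E => <-.
by apply: eq_bigr => k _; rewrite !mxE inordK.
Qed.

Lemma trunc_smul m A B : lower_triangular A ->
  trunc m (smul A B) = trunc m A *m trunc m B.
Proof.
move=> lA; apply/matrixP => i j; rewrite !mxE.
rewrite (@smulr_bound _ _ _ _ _ m); last by move=> k mk; rewrite lA// (leq_trans (ltn_ord i) mk).
by apply: eq_bigr => k _; rewrite !mxE.
Qed.

Section Unitriangular.
Variable S : smatrix F.
Hypothesis S_unitri : lower_unitriangular S.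

Lemma unitriangular_lower : lower_triangular S.
Proof. by case: S_unitri. Qed.

Lemma unitriangular_diag i : S i i != 0.
Proof. by case: S_unitri => -> _; rewrite oner_eq0. Qed.

Lemma unitriangular_sinv_lower : lower_triangular (sinv S).
Proof. exact: lower_triangular_sinv unitriangular_lower unitriangular_diag. Qed.

End Unitriangular.

(** A vanishing pivot [h k] would make the leading minor of size [k + 1]
    vanish. *)
Lemma is_LU_diag_neq0 G S1 h S2 : LU_factorizable G -> is_LU G S1 h S2 ->
  forall k, h k != 0.
Proof.
move=> LU [u1 u2 GE] k; have := LU k.+1 isT; apply: contra => /eqP hk0.
have l1 := unitriangular_sinv_lower u1.
have lD : lower_triangular (sdiag h) by move=> i j ij; rewrite /sdiag ltn_eqF.
have lM : lower_triangular (smul (sinv S1) (sdiag h)).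
  by move=> i j ij; rewrite smul_diagr l1 ?mul0r.
rewrite GE !trunc_smul// !det_mulmx.
rewrite [X in _ * X * _]det_trig; last first.
  by apply/is_trig_mxP => i j ij; rewrite mxE lD.
rewrite [\prod_(i < k.+1) _]big_ord_recr /= mxE /sdiag eqxx hk0.
by rewrite !(mulr0, mul0r).
Qed.

Lemma is_LU_str G S1 h S2 : is_LU G S1 h S2 -> is_LU (str G) S2 h S1.
Proof.
move=> [u1 u2 GE]; split=> //; rewrite GE !str_smul str_diag smulA_rr//.
  by apply: row_finite_lower; exact: unitriangular_sinv_lower.
exact: row_finite_diag.
Qed.

Lemma is_LU_smul_str G S1 h S2 : is_LU G S1 h S2 ->
  smul G (str S2) = smul (sinv S1) (sdiag h).
Proof.
move=> [u1 u2 ->].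
have r1 := row_finite_lower (unitriangular_sinv_lower u1).
have r2 := row_finite_lower (unitriangular_lower u2).
rewrite -smulA_rc//; last exact: row_finite_smul (row_finite_diag _).
rewrite -(str_smul S2) smul_sinvr; [|exact: unitriangular_lower|exact: unitriangular_diag].
by rewrite str_diag smuls1.
Qed.

(** With [G^T = G'^T Q(shift^T)], the resolvent is
    [h' S1'^-T Q(shift^T) S1^T h^-1 = S2' G'^T Q(shift^T) S1^T h^-1
     = S2' G^T S1^T h^-1], and [G^T S1^T = S2^-1 h].  The inner factor [G'^T]
    has neither finite rows nor finite columns, so the order in which the
    products are reassociated matters. *)
Lemma resolventE Q G S1 h S2 G' S1' h' S2' :
  is_LU G S1 h S2 -> is_LU G' S1' h' S2' -> (forall k, h k != 0) ->
  str G = smul (str G') (speval Q (str Defs.shift)) ->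
  resolvent Q h' S1' S1 h = smul S2' (sinv S2).
Proof.
move=> LU LU' h0 GG'; have [u1 u2 _] := LU; have [u1' u2' _] := LU'.
have rS1 := row_finite_lower (unitriangular_lower u1).
have rS2' := row_finite_lower (unitriangular_lower u2').
have rQ := row_finite_speval_shift Q.
have E' : smul S2' (str G') = smul (sdiag h') (str (sinv S1')).
  have := congr1 (@str F) (is_LU_smul_str LU').
  by rewrite !str_smul str_diag.
have E : smul (str G) (str S1) = smul (sinv S2) (sdiag h).
  by have := is_LU_smul_str (is_LU_str LU).
rewrite /resolvent -E' -(smulA_rc (str G') rS2' rQ) -GG'.
rewrite -(@smulA_rc _ S2' (str G) (str S1) rS2' rS1) E.
apply/funext => i; apply/funext => j; rewrite smul_diagr.
rewrite smulA_rr ?smul_diagr ?mulfK//.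
exact: row_finite_lower (unitriangular_sinv_lower u2).
Qed.

End Triangular.

(** * Integration against signed measures *)

Section ChargeIntegral.
Variable R : realType.
Local Notation borel_charge := (charge (measurableTypeR R) R).
Implicit Types (nu : borel_charge) (K : set R) (f g : R -> R).

Lemma cposE nu (A : set (measurableTypeR R)) : measurable A ->
  cpos nu A = nu (A `&` hahn_pos nu).
Proof.
move=> mA; have -> : cpos nu A =
  if A \in measurable then nu (A `&` hahn_pos nu) else 0%E by [].
by rewrite mem_set.
Qed.

Lemma cnegE nu (A : set (measurableTypeR R)) : measurable A ->
  cneg nu A = (- nu (A `&` hahn_neg nu))%E.
Proof.
move=> mA; have -> : cneg nu A = ((-1)%:E *
  if A \in measurable then nu (A `&` hahn_neg nu) else 0)%E by [].
by rewrite mem_set// mulN1e.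
Qed.

Lemma measurable_hahn_pos nu : measurable (hahn_pos nu).
Proof. by have [[]] := hahn_spec nu. Qed.

Lemma measurable_hahn_neg nu : measurable (hahn_neg nu).
Proof. by have [_ []] := hahn_spec nu. Qed.

Lemma cposB nu (A : set (measurableTypeR R)) : measurable A ->
  nu A = (cpos nu A - cneg nu A)%E.
Proof.
move=> mA; rewrite cposE// cnegE// oppeK -[in LHS](setIT A).
have [_ _ PN PN0] := hahn_spec nu; rewrite -PN setIUr chargeU//.
- by apply: measurableI => //; exact: measurable_hahn_pos.
- by apply: measurableI => //; exact: measurable_hahn_neg.
- by rewrite setIACA PN0 setI0.
Qed.

Lemma csupport_closed nu : closed (csupport nu).
Proof. by apply: open_closedC; apply: bigcup_open => U []. Qed.

Lemma measurable_csupport nu :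
  measurable (csupport nu : set (measurableTypeR R)).
Proof. exact: closed_measurable (@csupport_closed nu). Qed.

(** The union of the open null sets is the union of the null intervals with
    rational end points, which are countably many. *)
Lemma null_csupportC nu (mu : {measure set (measurableTypeR R) -> \bar R}) :
  (forall A : set (measurableTypeR R), measurable A ->
     (forall B : set (measurableTypeR R), measurable B -> B `<=` A ->
        nu B = 0%E) -> mu A = 0%E) ->
  mu (~` csupport nu) = 0%E.
Proof.
move=> mu0; rewrite /csupport setCK.
pose I (ab : rat * rat) : set (measurableTypeR R) :=
  [set` `]ratr ab.1, (ratr ab.2 : R)[].
pose null (U : set R) := forall A : set (measurableTypeR R),
  measurable A -> A `<=` U -> nu A = 0%E.
pose J n : set (measurableTypeR R) := if @unpickle (rat * rat)%type n is Some ab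
  then (if `[< null (I ab) >] then I ab else set0) else set0.
have nJ n : mu.-negligible (J n).
  rewrite /J; case: unpickle => [ab|]; last exact: negligible_set0.
  case: asboolP => [nI|_]; last exact: negligible_set0.
  apply/negligibleP; first exact: measurable_itv.
  by apply: mu0 => //; exact: measurable_itv.
have -> : \bigcup_(U in [set U | open U /\ null U]) U =
          \bigcup_n J n.
  apply/seteqP; split => [x [U [oU nU] Ux]|x [m _]]; last first.
    rewrite /J; case: unpickle => // ab; case: asboolP => // nI Ix.
    exists (I ab) => //.
  have [e /= e0 eU] : exists2 e : R, 0 < e & ball x e `<=` U.
    by have /nbhs_ballP[e /= e0 eU] := open_nbhs_nbhs (conj oU Ux); exists e.
  have /rat_in_itvoo[a] : x - e < x by rewrite ltrBlDr ltrDl.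
  have /rat_in_itvoo[b] : x < x + e by rewrite ltrDl.
  rewrite !in_itv /= => /andP[xb bx] /andP[xa ax].
  have [m mE] : exists m, @unpickle (rat * rat)%type m = Some (a, b).
    by exists (pickle (a, b)); rewrite pickleK.
  exists m => //; rewrite /J mE; case: asboolP => [nI|].
    by rewrite /I /= in_itv /= ax.
  case=> A mA AI; apply: nU => // y /AI; rewrite /I /= in_itv /= => /andP[ay yb].
  apply: eU; rewrite /ball /= ltr_distlC; apply/andP; split.
    exact: lt_trans ay.
  exact: lt_trans bx.
apply/negligibleP; last exact: negligible_bigcup.
apply: bigcupT_measurable => m; rewrite /J; case: unpickle => [ab|//].
by case: asboolP => // _; exact: measurable_itv.
Qed.

Lemma cpos_csupportC nu : cpos nu (~` csupport nu) = 0%E.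
Proof.
apply: (@null_csupportC nu) => A mA nuA0; rewrite cposE// nuA0//.
by apply: measurableI => //; exact: measurable_hahn_pos.
Qed.

Lemma cneg_csupportC nu : cneg nu (~` csupport nu) = 0%E.
Proof.
apply: (@null_csupportC nu) => A mA nuA0; rewrite cnegE// nuA0 ?oppe0//.
by apply: measurableI => //; exact: measurable_hahn_neg.
Qed.

(** Domination by a polynomial, unlike integrability, is stable under products,
    and it implies integrability against the entries of a measure matrix.
    Measurability is asked on the whole line, so that integrals over the support
    can be traded for integrals over the line. *)
Definition tame K f : Prop := measurable_fun setT f /\
  exists p : {poly R}, forall x, K x -> `|f x| <= p.[x].

Lemma tame_subset K K' f : K `<=` K' -> tame K' f -> tame K f.
Proof. by move=> KK' [mf [p fp]]; split => //; exists p => x /KK'; exact: fp. Qed.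

Lemma measurable_horner (p : {poly R}) : measurable_fun setT (horner p).
Proof. by apply: continuous_measurable_fun; exact: continuous_horner. Qed.

Lemma tame_horner K (p : {poly R}) : tame K (horner p).
Proof.
split; first exact: measurable_horner.
(* [|t| <= t^2 + 1] turns the absolute value into a polynomial bound *)
exists (p ^+ 2 + 1) => x _; rewrite hornerD horner_exp hornerC -real_normK ?num_real//.
by have := sqr_ge0 (`|p.[x]| - 1); have := normr_ge0 p.[x]; nra.
Qed.

Lemma tame_cst K (c : R) : tame K (fun=> c).
Proof. by have := tame_horner K c%:P; rewrite hornerC_ext. Qed.

Lemma tameD K f g : tame K f -> tame K g -> tame K (fun x => f x + g x).
Proof.
move=> [mf [p fp]] [mg [r gr]]; split; first exact: measurable_funD.
exists (p + r) => x Kx; rewrite hornerD (le_trans (ler_normD _ _))//.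
by rewrite lerD ?fp ?gr.
Qed.

Lemma tameM K f g : tame K f -> tame K g -> tame K (fun x => f x * g x).
Proof.
move=> [mf [p fp]] [mg [r gr]]; split; first exact: measurable_funM.
by exists (p * r) => x Kx; rewrite hornerM normrM ler_pM ?fp ?gr.
Qed.

Lemma tameZ K (c : R) f : tame K f -> tame K (fun x => c * f x).
Proof. by move=> tf; apply: tameM => //; exact: tame_cst. Qed.

Lemma tame_sum K (I : Type) (r : seq I) (P : pred I) (F : I -> R -> R) :
  (forall i, P i -> tame K (F i)) -> tame K (fun x => \sum_(i <- r | P i) F i x).
Proof.
move=> tF; elim: r => [|i r IH].
  by under eq_fun do rewrite big_nil; exact: tame_cst.
under eq_fun do rewrite big_cons.
by case Pi: (P i) => //; apply: tameD => //; exact: tF.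
Qed.

Lemma tame_indic K (A : set (measurableTypeR R)) : measurable A ->
  tame K (\1_A : R -> R).
Proof.
move=> mA; split; first exact: measurable_indic.
exists 1 => x _; rewrite hornerC indicE; by case: (_ \in _); rewrite ?normr1 ?normr0.
Qed.

Lemma tame_integrable_measure K (mu : {measure set (measurableTypeR R) -> \bar R}) f :
  measurable (K : set (measurableTypeR R)) -> mu (~` K) = 0%E ->
  (forall p : {poly R}, mu.-integrable K (EFin \o horner p)) ->
  tame K f -> mu.-integrable setT (EFin \o f).
Proof.
move=> mK muK ip [mf [p fp]].
have mf' : measurable_fun setT (EFin \o f) by apply/measurable_EFinP.
apply/(negligible_integrable (measurableC mK)) => //.
rewrite setTD setCK; apply: (le_integrable mK _ _ (ip p)).
  exact: measurable_funS mf'.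
by move=> x /fp fx; rewrite /= lee_fin (le_trans fx)// ler_norm.
Qed.

Section PolynomiallyIntegrable.
Variable nu : borel_charge.
Hypothesis nu_poly : forall p : {poly R}, cintegrable nu (csupport nu) (horner p).
Local Notation K := (csupport nu).

Lemma tame_integrable f : tame K f -> cintegrable nu setT f.
Proof.
move=> tf; split; apply: (tame_integrable_measure (@measurable_csupport nu)) => //.
- exact: cpos_csupportC.
- by move=> p; have [] := nu_poly p.
- exact: cneg_csupportC.
- by move=> p; have [] := nu_poly p.
Qed.

Lemma cintegral_csupport f : tame K f ->
  cintegral nu K f = cintegral nu setT f.
Proof.
move=> tf; have [ip im] := tame_integrable tf.
have mK := measurableC (@measurable_csupport nu).
rewrite /cintegral /Rintegral.
rewrite (negligible_integral mK _ ip) ?cpos_csupportC//.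
by rewrite (negligible_integral mK _ im) ?cneg_csupportC// setTD setCK.
Qed.

Lemma cintegral_lin (a : R) f g : tame K f -> tame K g ->
  cintegral nu setT (fun x => a * f x + g x) =
  a * cintegral nu setT f + cintegral nu setT g.
Proof.
move=> tf tg; have taf := tameZ a tf.
have [fp fm] := tame_integrable tf; have [gp gm] := tame_integrable tg.
have [afp afm] := tame_integrable taf.
rewrite /cintegral !RintegralD// !RintegralZl//.
by rewrite mulrBr opprD addrACA.
Qed.

Lemma cintegral_sum (I : Type) (r : seq I) (F : I -> R -> R) :
  (forall i, tame K (F i)) ->
  cintegral nu setT (fun x => \sum_(i <- r) F i x) =
  \sum_(i <- r) cintegral nu setT (F i).
Proof.
move=> tF; elim: r => [|i r IH].
  rewrite big_nil; under eq_fun do rewrite big_nil.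
  by rewrite /cintegral !Rintegral_cst// !mul0r subrr.
rewrite big_cons; under eq_fun do rewrite big_cons.
have tS : tame K (fun x => \sum_(i <- r) F i x) by exact: tame_sum.
have := cintegral_lin 1 (tF i) tS.
rewrite mul1r IH => <-; congr cintegral; apply/funext => x.
by rewrite mul1r.
Qed.

Lemma cintegral_dominated (f_ : nat -> R -> R) f g :
  (forall n, tame K (f_ n)) -> tame K f -> tame K g ->
  (forall n x, `|f_ n x| <= g x) ->
  (forall x, f_ ^~ x @ \oo --> f x) ->
  (fun n => cintegral nu setT (f_ n)) @ \oo --> cintegral nu setT f.
Proof.
move=> tf_ tf tg fg cf.
have mE h : tame K h -> measurable_fun setT (EFin \o h).
  by case=> mh _; apply/measurable_EFinP.
have H (mu : {measure set (measurableTypeR R) -> \bar R}) :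
    mu.-integrable setT (EFin \o g) -> mu.-integrable setT (EFin \o f) ->
    (fun n => Rintegral mu setT (f_ n)) @ \oo --> Rintegral mu setT f.
  move=> ig if'; apply: fine_cvg; rewrite fineK; last exact: integrable_fin_num.
  have [] := @dominated_convergence _ _ _ mu setT measurableT
    (fun n => EFin \o f_ n) (EFin \o f) (EFin \o g) => //.
  - by move=> n; exact: mE.
  - exact: mE.
  - by apply: aeW => x _; apply: cvg_EFin => //; [exact: nearW|exact: cf].
  - by apply: aeW => x n _; rewrite /= lee_fin.
have [fp fm] := tame_integrable tf; have [gp gm] := tame_integrable tg.
by apply: cvgB; exact: H.
Qed.

Lemma cintegral_indic (A : set (measurableTypeR R)) f : measurable A ->
  cintegral nu setT (fun x => \1_A x * f x) = cintegral nu A f.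
Proof.
move=> mA; rewrite /cintegral [in RHS]Rintegral_mkcond.
rewrite [X in _ = _ - X]Rintegral_mkcond.
suff -> : (fun x => \1_A x * f x) = f \_ A by [].
apply/funext => x; rewrite patchE indicE.
by case: (x \in A); rewrite ?mul1r ?mul0r.
Qed.

Lemma cintegral1 (A : set (measurableTypeR R)) : measurable A ->
  (cintegral nu A (fun=> 1))%:E = nu A.
Proof.
move=> mA; rewrite /cintegral !Rintegral_cst// !mul1r cposB// EFinB.
by rewrite !fineK// ?cposE ?cnegE// ?fin_numN; apply: fin_num_measure;
  apply: measurableI => //; [exact: measurable_hahn_neg|exact: measurable_hahn_pos].
Qed.

End PolynomiallyIntegrable.

End ChargeIntegral.

(** * Integration against densities and point masses *)

Section DominatedContinuity.
Variable R : realType.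
Local Notation borel_charge := (charge (measurableTypeR R) R).
Implicit Types (nu : borel_charge) (K : set R) (f g : R -> R).

(** The functionals to be compared, integration against a signed measure with a
    density and evaluation at a point, have in common linearity and dominated
    convergence; these two properties determine a functional from its values on
    indicators. *)
Definition dominated_continuous K (I : (R -> R) -> R) : Prop :=
  (forall a f g, tame K f -> tame K g ->
     I (fun x => a * f x + g x) = a * I f + I g) /\
  (forall (f_ : nat -> R -> R) f g,
     (forall n, tame K (f_ n)) -> tame K f -> tame K g ->
     (forall n x, `|f_ n x| <= g x) -> (forall x, f_ ^~ x @ \oo --> f x) ->
     (fun n => I (f_ n)) @ \oo --> I f).

Lemma tame_norm K f : tame K f -> tame K (fun x => `|f x|).
Proof.
move=> [mf [p fp]]; split; first exact: measurableT_comp.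
by exists p => x Kx; rewrite normr_id fp.
Qed.

Lemma dominated_continuous_cintegral nu K (phi : R -> R) :
  (forall p : {poly R}, cintegrable nu (csupport nu) (horner p)) ->
  csupport nu `<=` K -> tame (csupport nu) phi ->
  dominated_continuous K (fun f => cintegral nu setT (fun x => f x * phi x)).
Proof.
move=> nu_poly nuK tphi; have tK f (tf : tame K f) := tame_subset nuK tf.
split=> [a f g /tK tf /tK tg|f_ f g tf_ tf tg fg cf].
  rewrite -(cintegral_lin nu_poly a (tameM tf tphi) (tameM tg tphi)).
  by congr cintegral; apply/funext => x; rewrite mulrDl mulrA.
apply: (cintegral_dominated nu_poly (g := fun x => g x * `|phi x|)).
- by move=> n; apply: tameM => //; exact: tK.
- by apply: tameM => //; exact: tK.
- by apply: tameM; [exact: tK|exact: tame_norm].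
- by move=> n x; rewrite normrM ler_wpM2r.
- by move=> x; apply: cvgM; [exact: cf|exact: cvg_cst].
Qed.

Lemma dominated_continuous_eval K (c q : R) :
  dominated_continuous K (fun f => c * f q).
Proof.
split=> [a f g _ _|f_ f g _ _ _ _ cf]; first by rewrite mulrDr mulrCA.
by apply: cvgM; [exact: cvg_cst|exact: cf].
Qed.

Lemma dominated_continuousD K I J :
  dominated_continuous K I -> dominated_continuous K J ->
  dominated_continuous K (fun f => I f + J f).
Proof.
move=> [Il Ic] [Jl Jc]; split=> [a f g tf tg|f_ f g tf_ tf tg fg cf].
  by rewrite Il// Jl// mulrDr addrACA.
by apply: cvgD; [exact: Ic fg cf|exact: Jc fg cf].
Qed.

Lemma dominated_continuous_sum K (T : Type) (r : seq T)
    (I : T -> (R -> R) -> R) :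
  (forall i, dominated_continuous K (I i)) ->
  dominated_continuous K (fun f => \sum_(i <- r) I i f).
Proof.
move=> dI; elim: r => [|i r IH].
  under eq_fun do rewrite big_nil.
  split=> [a f g _ _|*]; first by rewrite mulr0 addr0.
  exact: cvg_cst.
under eq_fun do rewrite big_cons.
exact: dominated_continuousD.
Qed.

Lemma dominated_continuous_lin_sum K I (T : Type) (r : seq T) (c : T -> R)
    (F : T -> R -> R) : dominated_continuous K I -> (forall i, tame K (F i)) ->
  I (fun x => \sum_(i <- r) c i * F i x) = \sum_(i <- r) c i * I (F i).
Proof.
move=> [Il _] tF.
have I0 : I (fun=> 0) = 0.
  have := Il (-1) _ _ (tame_cst K 0) (tame_cst K 0).
  by rewrite mulr0 addr0 mulN1r addNr.
elim: r => [|i r IH]; first by rewrite big_nil; under eq_fun do rewrite big_nil.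
rewrite big_cons -IH -Il//; last by apply: tame_sum => j _; exact: tameZ.
by under eq_fun do rewrite big_cons.
Qed.

Import HBNNSimple.

(** The usual extension from indicators to simple functions, to nonnegative
    functions as monotone limits, and to differences of nonnegative functions. *)
Lemma dominated_continuous_unique K I J :
  dominated_continuous K I -> dominated_continuous K J ->
  (forall A : set (measurableTypeR R), measurable A -> I \1_A = J \1_A) ->
  forall f, tame K f -> I f = J f.
Proof.
move=> dI dJ IJ; have [Il Ic] := dI; have [Jl Jc] := dJ.
have tsimple (h : {nnsfun R >-> R}) : tame K h /\ I h = J h.
  have mh y : measurable (h @^-1` [set y]) by exact: measurable_funPTI.
  have [s ->] : exists s : seq R,
      (h : R -> R) = (fun x => \sum_(y <- s) y * \1_(h @^-1` [set y]) x).
    by eexists; apply/funext => x; rewrite fimfunE fsbig_finite.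
  split; first by apply: tame_sum => y _; apply: tameZ; exact: tame_indic (mh y).
  rewrite !(dominated_continuous_lin_sum (K := K))//; last 2 first.
  - by move=> y; exact: tame_indic (mh y).
  - by move=> y; exact: tame_indic (mh y).
  by apply: eq_bigr => y _; rewrite (IJ _ (mh y)).
have IJ0 f : tame K f -> (forall x, 0 <= f x) -> I f = J f.
  move=> tf f0.
  have mf : measurable_fun setT (EFin \o f).
    by apply/measurable_EFinP; have [] := tf.
  pose f_ n : R -> R := nnsfun_approx measurableT mf n.
  have f_f n x : `|f_ n x| <= f x.
    rewrite ger0_norm; last exact: fun_ge0.
    rewrite /f_ nnsfun_approxE -lee_fin.
    by apply: (le_approx (D := setT)) => // y _; rewrite lee_fin.
  have cf x : f_ ^~ x @ \oo --> f x.
    have H y : setT y -> (0 <= (EFin \o f) y)%E by rewrite lee_fin.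
    have := cvg_nnsfun_approx measurableT mf H (x := x) Logic.I.
    by move=> /(@fine_cvg _ _ _ _ _ (f x)); exact.
  have tf_ n : tame K (f_ n) by have [] := tsimple (nnsfun_approx measurableT mf n).
  have /(cvg_lim (@Rhausdorff R)) <- := Ic _ _ _ tf_ tf tf f_f cf.
  have /(cvg_lim (@Rhausdorff R)) <- := Jc _ _ _ tf_ tf tf f_f cf.
  congr (lim (_ @ \oo)); apply/funext => n.
  by have [] := tsimple (nnsfun_approx measurableT mf n).
move=> f tf; have tn := tame_norm tf; have tfn := tameD tf tn.
(* [f = (f + |f|) - |f|], a difference of nonnegative tame functions *)
have -> : f = (fun x => -1 * `|f x| + (f x + `|f x|)).
  by apply/funext => x; rewrite mulN1r addrCA addNr addr0.
rewrite Il// Jl// !IJ0// => x.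
by rewrite -lerBlDl sub0r -normrN ler_norm.
Qed.

(** Passage from the set function [nu] to integrals.  The domination set [K] must
    contain the supports of all the measures involved, while the densities need
    only be controlled on the supports of the measures that they multiply. *)
Lemma cintegral_density nu K (T : Type) (r : seq T) (mu : T -> borel_charge)
    (phi : T -> R -> R) (U : Type) (u : seq U) (c q : U -> R) :
  (forall p : {poly R}, cintegrable nu (csupport nu) (horner p)) ->
  (forall k (p : {poly R}), cintegrable (mu k) (csupport (mu k)) (horner p)) ->
  csupport nu `<=` K -> (forall k, csupport (mu k) `<=` K) ->
  (forall k, tame (csupport (mu k)) (phi k)) ->
  (forall A : set (measurableTypeR R), measurable A ->
     nu A = ((\sum_(k <- r) cintegral (mu k) A (phi k))%:E +
             \sum_(l <- u) (c l)%:E * dirac (q l : measurableTypeR R) A)%E) ->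
  forall f, tame K f ->
  cintegral nu setT f =
    \sum_(k <- r) cintegral (mu k) setT (fun x => f x * phi k x) +
    \sum_(l <- u) c l * f (q l).
Proof.
move=> nu_poly mu_poly nuK muK tphi nuE f tf.
have -> : f = (fun x => f x * 1) by apply/funext => x; rewrite mulr1.
under [in RHS]eq_bigr do under eq_fun do rewrite mulr1.
under [X in _ = _ + X]eq_bigr do rewrite mulr1.
apply: (dominated_continuous_unique
  (I := fun f => cintegral nu setT (fun x => f x * 1))
  (J := fun f => \sum_(k <- r) cintegral (mu k) setT (fun x => f x * phi k x) +
    \sum_(l <- u) c l * f (q l))) tf.
- by apply: dominated_continuous_cintegral => //; exact: tame_cst.
- apply: dominated_continuousD; apply: dominated_continuous_sum => k.
    exact: dominated_continuous_cintegral.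
  exact: dominated_continuous_eval.
move=> A mA; apply: EFin_inj; rewrite cintegral_indic// cintegral1// nuE// EFinD.
congr ((_)%:E + _)%E.
  by apply: eq_bigr => k _; rewrite cintegral_indic.
by rewrite -sumEFin; apply: eq_bigr => l _; rewrite EFinM diracE indicE.
Qed.

End DominatedContinuity.

(** * Derivatives of rational functions and Leibniz's rule *)

Section Jets.
Variable R : realType.
Implicit Types (K U : set R) (f g : R -> R) (F G : nat -> R -> R).
Implicit Types (p d Q : {poly R}) (x : R).

(** [F n] stands for the [n]-th derivative of [f]: it coincides with it on a
    neighbourhood of [K], but is chosen measurable on the whole line, unlike the
    derivatives themselves, about which nothing is known off that
    neighbourhood. *)
Definition jet K f F : Prop := (exists U : set R,
  [/\ open U, K `<=` U, forall x, U x -> f x = F 0%N x &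
      forall n x, U x -> is_derive x (1 : R) (F n) (F n.+1 x)]) /\
  forall n, tame K (F n).

Lemma jet_derive1n K f F n x : jet K f F -> K x -> derive1n n f x = F n x.
Proof.
move=> [[U [oU KU fF dF]] _] /KU; elim: n x => [|n IH] x Ux; first exact: fF.
rewrite derive1nS derive1E; have [_ <-] := dF n x Ux.
apply: near_eq_derive; near=> z; apply: IH; near: z.
exact: open_nbhs_nbhs.
Unshelve. all: by end_near. Qed.

Lemma jet_subset K K' f F : K `<=` K' -> jet K' f F -> jet K f F.
Proof.
move=> KK' [[U [oU KU fF dF]] tF]; split; last by move=> n; exact: tame_subset (tF n).
by exists U; split=> //; exact: subset_trans KU.
Qed.

Lemma jet_eq K U f g F : open U -> K `<=` U -> (forall x, U x -> f x = g x) ->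
  jet K f F -> jet K g F.
Proof.
move=> oU KU fg [[V [oV KV fF dF]] tF]; split=> //; exists (U `&` V); split.
- exact: openI.
- by move=> x Kx; split; [exact: KU|exact: KV].
- by move=> x [Ux Vx]; rewrite -fg// fF.
- by move=> n x [_ Vx]; exact: dF.
Qed.

Lemma jet_lin K (a : R) f g F G : jet K f F -> jet K g G ->
  jet K (fun x => a * f x + g x) (fun n x => a * F n x + G n x).
Proof.
move=> [[U [oU KU fF dF]] tF] [[V [oV KV gG dG]] tG]; split; last first.
  by move=> n; apply: tameD => //; exact: tameZ.
exists (U `&` V); split.
- exact: openI.
- by move=> x Kx; split; [exact: KU|exact: KV].
- by move=> x [Ux Vx]; rewrite fF// gG.
- move=> n x [Ux Vx]; have dFx := dF n x Ux; have dGx := dG n x Vx.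
  exact: (is_deriveD (is_deriveZ a dFx) dGx).
Qed.

Lemma jet0 K : jet K (fun=> 0) (fun _ _ => 0).
Proof.
split; last by move=> n; exact: tame_cst.
by exists setT; split=> //; [exact: openT|move=> n x _; exact: is_derive_cst].
Qed.

Lemma jet_horner K p : jet K (horner p) (fun n => horner (p^`(n))).
Proof.
split; last by move=> n; exact: tame_horner.
exists setT; split=> //; first exact: openT.
by move=> n x _; rewrite derivnS; exact: is_derive_poly.
Qed.

Definition leibniz Q F n x : R :=
  \sum_(j < n.+1) (Q^`(n - j).[x] *+ 'C(n, j)) * F j x.

(** Differentiating term [j] yields a multiple of [F j] and one of [F j.+1]; the
    coefficients recombine by Pascal's rule [binS]. *)
Lemma is_derive_leibniz Q F x :
  (forall n, is_derive x (1 : R) (F n) (F n.+1 x)) ->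
  forall n, is_derive x (1 : R) (leibniz Q F n) (leibniz Q F n.+1 x).
Proof.
move=> dF n.
pose h (j : 'I_n.+1) y := (Q^`(n - j).[y] *+ 'C(n, j)) * F j y.
have dh j : is_derive x (1 : R) (h j)
    ((Q^`((n - j).+1).[x] *+ 'C(n, j)) * F j x +
     (Q^`(n - j).[x] *+ 'C(n, j)) * F j.+1 x).
  have -> : h j = horner (Q^`(n - j) *+ 'C(n, j)) * F j.
    by apply/funext => y; rewrite /h -hornerMn.
  have dp := is_derive_poly (Q^`(n - j) *+ 'C(n, j)) x.
  apply: (is_derive_eq (is_deriveM dp (dF j))).
  by rewrite derivMn -derivnS !hornerMn addrC [X in X + _]mulrC.
have -> : leibniz Q F n = \sum_(j < n.+1) h j.
  by apply/funext => y; rewrite fct_sumE.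
apply: (is_derive_eq (is_derive_sum dh)); rewrite big_split /= /leibniz.
rewrite [in LHS]big_ord_recl [RHS]big_ord_recl /= !bin0 !subn0 -addrA; congr (_ + _).
under [RHS]eq_bigr => j _.
  rewrite /bump /= add1n subSS binS mulrnDr mulrDl; over.
rewrite big_split /=; congr (_ + _).
rewrite [RHS]big_ord_recr /= bin_small ?leqnn// mulr0n mul0r addr0.
by apply: eq_bigr => j _; rewrite /bump /= add1n -derivnS subnSK.
Qed.

Lemma jet_leibniz K Q f F : jet K f F ->
  jet K (fun x => Q.[x] * f x) (leibniz Q F).
Proof.
move=> [[U [oU KU fF dF]] tF]; split; last first.
  move=> n; apply: tame_sum => j _; apply: tameM => //.
  under eq_fun do rewrite -hornerMn; exact: tame_horner.
exists U; split=> //.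
  by move=> x Ux; rewrite /leibniz big_ord_recl big_ord0 addr0 /= ?bin0 mulr1n fF.
by move=> n x Ux; apply: is_derive_leibniz => m; exact: dF.
Qed.

(** A uniform bound, rather than the mere absence of zeros: [K] is unbounded in
    general, and reciprocals have to be dominated on it. *)
Definition away_from_zero K d : Prop :=
  exists2 c : R, 0 < c & forall x, K x -> c <= `|d.[x]|.

Lemma away_from_zeroM K d d' : away_from_zero K d -> away_from_zero K d' ->
  away_from_zero K (d * d').
Proof.
move=> [c c0 cd] [c' c'0 cd']; exists (c * c'); first exact: mulr_gt0.
by move=> x Kx; rewrite hornerM normrM; apply: ler_pM; rewrite ?(ltW c0) ?(ltW c'0) ?cd ?cd'.
Qed.

Lemma away_from_zero1 K : away_from_zero K 1.
Proof. by exists 1 => // x _; rewrite hornerC normr1. Qed.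

Lemma away_from_zeroX K d n : away_from_zero K d -> away_from_zero K (d ^+ n).
Proof.
move=> Kd; elim: n => [|n IH]; first exact: away_from_zero1.
by rewrite exprS; exact: away_from_zeroM.
Qed.

Lemma away_from_zero_neq0 K d x : away_from_zero K d -> K x -> d.[x] != 0.
Proof. by move=> [c c0 cd] /cd cx; rewrite -normr_gt0 (lt_le_trans c0). Qed.

Lemma away_from_zero_XsubC K (a : R) : closed K -> ~ K a ->
  away_from_zero K ('X - a%:P).
Proof.
move=> cK Ka; have oK : open (~` K) by exact: closed_openC.
have /nbhs_ballP[e /= e0 eK] := open_nbhs_nbhs (conj oK Ka).
exists e => // x Kx; rewrite hornerXsubC leNgt; apply/negP => xa.
by apply: (eK x) => //; rewrite /ball /= distrC.
Qed.

Definition rat_eval (pd : {poly R} * {poly R}) x : R := pd.1.[x] / pd.2.[x].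

(** Quotient rule on numerators and denominators; the denominator is left
    unsimplified, so that those of all derivatives are powers of the first
    one. *)
Definition rat_deriv (pd : {poly R} * {poly R}) :=
  (pd.1^`() * pd.2 - pd.1 * pd.2^`(), pd.2 ^+ 2).

(** The inverse is continuous off [0]; its value there is a convention. *)
Lemma measurable_invr : measurable_fun setT (@GRing.inv R).
Proof.
rewrite -(setvU [set 0]); apply/measurable_funU.
- by apply: measurableC; exact: measurable_set1.
- exact: measurable_set1.
split; last exact: measurable_fun_set1.
apply: open_continuous_measurable_fun.
  by apply: closed_openC; exact: closed_eq.
move=> x; rewrite inE /= => x0; apply: inv_continuous; exact/eqP.
Qed.

Lemma tame_rat K p d : away_from_zero K d -> tame K (rat_eval (p, d)).
Proof.
move=> [c c0 cd]; apply: tameM; first exact: tame_horner.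
split.
  apply: measurableT_comp; first exact: measurable_invr.
  exact: measurable_horner.
exists (c^-1)%:P => x Kx; rewrite hornerC normfV lef_pV2 ?cd// posrE.
exact: lt_le_trans (cd x Kx).
Qed.

Lemma is_derive_rat pd x : pd.2.[x] != 0 ->
  is_derive x (1 : R) (rat_eval pd) (rat_eval (rat_deriv pd) x).
Proof.
move=> dx; have dp := is_derive_poly pd.1 x; have dd := is_derive_poly pd.2 x.
apply: (is_derive_eq (is_deriveM dp (is_deriveV dx dd))).
rewrite /rat_eval /rat_deriv /= !hornerE /= /GRing.scale /=.
by field.
Qed.

Lemma jet_rat K p d : away_from_zero K d ->
  jet K (rat_eval (p, d)) (fun n => rat_eval (iter n rat_deriv (p, d))).
Proof.
move=> Kd; split; last first.
  move=> n; have : away_from_zero K (iter n rat_deriv (p, d)).2.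
    by elim: n => // n IH; exact: away_from_zeroX.
  by case: (iter _ _ _) => p' d' /=; exact: tame_rat.
exists [set x | d.[x] != 0]; split => //.
- have -> : [set x | d.[x] != 0] = horner d @^-1` (~` [set 0]).
    by apply/seteqP; split => x /= /eqP.
  apply: open_comp; first by move=> x _; exact: continuous_horner.
  by apply: closed_openC; exact: closed_eq.
- by move=> x Kx; exact: away_from_zero_neq0 Kd Kx.
move=> n x /= dx; apply: is_derive_rat.
by elim: n => //= n IH; rewrite horner_exp expf_neq0.
Qed.

End Jets.

(** * The Sobolev bilinear form on smooth functions *)

Section MeasureMatrix.
Variable R : realType.
Local Notation borel_charge := (charge (measurableTypeR R) R).
Implicit Types (W : measure_matrix R) (K U : set R) (f g h : R -> R).

Lemma csupport_Omega W i j : csupport (W i j) `<=` Omega W.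
Proof. by move=> x Wx; exists (i, j). Qed.

Lemma csupport_eq0 W i j : (morder W < i)%N \/ (morder W < j)%N ->
  csupport (W i j) = set0.
Proof.
move=> ij; rewrite /csupport -[RHS]setCT; congr (~` _).
apply/seteqP; split => // x _; exists setT => //; split; first exact: openT.
by move=> A mA _; rewrite mentry_eq0.
Qed.

Lemma closed_Omega W : closed (Omega W).
Proof.
have -> : Omega W = \bigcup_(i in `I_(morder W).+1)
    \bigcup_(j in `I_(morder W).+1) csupport (W i j).
  apply/seteqP; split => x; last first.
    by move=> [i _ [j _ Wx]]; exact: csupport_Omega Wx.
  move=> [[i j] _ /= Wx]; have [ij|ij] := leqP i (morder W); last first.
    by move: Wx; rewrite csupport_eq0 //; left.
  have [jW|jW] := leqP j (morder W); last first.
    by move: Wx; rewrite csupport_eq0 //; right.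
  by exists i => //; exists j.
apply: closed_bigcup; first exact: finite_II.
move=> i _; apply: closed_bigcup; first exact: finite_II.
move=> j _; exact: csupport_closed.
Qed.

Definition smooth K f : Prop := exists F, jet K f F.

Lemma smooth_subset K K' f : K `<=` K' -> smooth K' f -> smooth K f.
Proof. by move=> KK' [F jF]; exists F; exact: jet_subset jF. Qed.

Lemma smooth0 K : smooth K (fun=> 0).
Proof. by exists (fun _ _ => 0); exact: jet0. Qed.

Lemma smooth_horner K (p : {poly R}) : smooth K (horner p).
Proof. by eexists; exact: jet_horner. Qed.

Lemma smooth_lin K (a : R) f g : smooth K f -> smooth K g ->
  smooth K (fun x => a * f x + g x).
Proof. by move=> [F jF] [G jG]; eexists; exact: jet_lin jF jG. Qed.

(** The bounds of the sums are arbitrary beyond the order of [W], which allows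
    sums for matrices of different orders to be compared. *)
Lemma pairing_jet W K f F h H (M1 M2 : nat) : Omega W `<=` K ->
  jet K f F -> jet K h H -> (morder W < M1)%N -> (morder W < M2)%N ->
  pairing W f h = \sum_(n < M1) \sum_(r < M2)
    cintegral (W n r) setT (fun x => F n x * H r x).
Proof.
move=> WK jF jH W1 W2; have [_ tF] := jF; have [_ tH] := jH.
have tFH n r : tame (csupport (W n r)) (fun x => F n x * H r x).
  apply: (@tame_subset _ _ K); last exact: tameM.
  exact: subset_trans (@csupport_Omega W n r) WK.
have cE n r : cintegral (W n r) (csupport (W n r))
    (fun x => derive1n n f x * derive1n r h x) =
  cintegral (W n r) setT (fun x => F n x * H r x).
  rewrite -(cintegral_csupport (mentry_poly W n r)) //.
  have E : {in csupport (W n r), (fun x => derive1n n f x * derive1n r h x) =1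
      (fun x => F n x * H r x)}.
    move=> x; rewrite inE => /csupport_Omega/WK Kx.
    by rewrite (jet_derive1n _ jF) // (jet_derive1n _ jH).
  by rewrite /cintegral; congr (_ - _); apply: eq_Rintegral; exact: E.
have c0 n r : (morder W < n)%N \/ (morder W < r)%N ->
    cintegral (W n r) setT (fun x => F n x * H r x) = 0.
  move=> nr; rewrite -(cintegral_csupport (mentry_poly W n r)) // csupport_eq0 //.
  by rewrite /cintegral !Rintegral_set0 subrr.
rewrite /pairing; under eq_bigr do under eq_bigr do rewrite cE.
rewrite (big_ord_widen _ (fun n => \sum_(r < (morder W).+1)
  cintegral (W n r) setT (fun x => F n x * H r x)) W1) big_mkcond /=.
apply: eq_bigr => n _; case: ltnP => nW; last first.
  by rewrite big1 // => r _; apply: c0; left.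
rewrite (big_ord_widen _ (fun r =>
  cintegral (W n r) setT (fun x => F n x * H r x)) W2) big_mkcond /=.
apply: eq_bigr => r _; case: ltnP => // rW.
by rewrite c0 //; right.
Qed.

Lemma pairing_eq W K U f g h : Omega W `<=` K -> open U -> K `<=` U ->
  (forall x, U x -> f x = g x) -> smooth K f -> smooth K h ->
  pairing W f h = pairing W g h.
Proof.
move=> WK oU KU fg [F jF] [H jH].
rewrite (pairing_jet WK jF jH (ltnSn _) (ltnSn _)).
by rewrite (pairing_jet WK (jet_eq oU KU fg jF) jH (ltnSn _) (ltnSn _)).
Qed.

Lemma pairing_linl W K (a : R) f g h : Omega W `<=` K ->
  smooth K f -> smooth K g -> smooth K h ->
  pairing W (fun x => a * f x + g x) h = a * pairing W f h + pairing W g h.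
Proof.
move=> WK [F jF] [G jG] [H jH].
rewrite (pairing_jet WK (jet_lin a jF jG) jH (ltnSn _) (ltnSn _)).
rewrite (pairing_jet WK jF jH (ltnSn _) (ltnSn _)).
rewrite (pairing_jet WK jG jH (ltnSn _) (ltnSn _)).
have tW n r k : tame K k -> tame (csupport (W n r)) k.
  by apply: tame_subset; exact: subset_trans (@csupport_Omega W n r) WK.
have [_ tF] := jF; have [_ tG] := jG; have [_ tH] := jH.
rewrite mulr_sumr -big_split /=; apply: eq_bigr => n _.
rewrite mulr_sumr -big_split /=; apply: eq_bigr => r _.
rewrite -(cintegral_lin (mentry_poly W n r)); last 2 first.
- by apply: tW; exact: tameM.
- by apply: tW; exact: tameM.
by congr cintegral; apply/funext => x; rewrite mulrDl mulrA.
Qed.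

Lemma pairing0l W h : smooth (Omega W) h -> pairing W (fun=> 0) h = 0.
Proof.
move=> sh; have := pairing_linl (-1) (@subset_refl _ _) (smooth0 _) (smooth0 _) sh.
by rewrite mulr0 addr0 mulN1r addNr.
Qed.

Lemma pairing_suml W K (I : Type) (r : seq I) (c : I -> R) (f : I -> R -> R) h :
  Omega W `<=` K -> (forall i, smooth K (f i)) -> smooth K h ->
  smooth K (fun x => \sum_(i <- r) c i * f i x) /\
  pairing W (fun x => \sum_(i <- r) c i * f i x) h =
  \sum_(i <- r) c i * pairing W (f i) h.
Proof.
move=> WK sf sh; elim: r => [|i r [sr IH]].
  rewrite big_nil; under eq_fun do rewrite big_nil.
  by split; [exact: smooth0|apply: pairing0l; exact: smooth_subset WK sh].
rewrite big_cons; under eq_fun do rewrite big_cons.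
by split; [exact: smooth_lin|rewrite (pairing_linl _ WK)// IH].
Qed.

Section Transpose.
Variable W : measure_matrix R.

Lemma mtr_eq0 i j : (morder W < i)%N \/ (morder W < j)%N ->
  forall A : set (measurableTypeR R), measurable A -> W j i A = 0%E.
Proof. by move=> ij A mA; apply: mentry_eq0 => //; case: ij; [right|left]. Qed.

(** Transposition exchanges the two arguments of the bilinear form, hence the
    roles of the left and right deformations. *)
Definition mtr : measure_matrix R :=
  @MeasureMatrix R (morder W) (fun i j => W j i) mtr_eq0
    (fun i j => mentry_poly W j i).

Lemma Omega_mtr : Omega mtr = Omega W.
Proof. by apply/seteqP; split => x [[i j] _ /= Wx]; exists (j, i). Qed.

Lemma pairing_mtr f h : pairing mtr f h = pairing W h f.
Proof.
rewrite /pairing /= exchange_big /=; apply: eq_bigr => n _.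
apply: eq_bigr => r _; congr cintegral; apply/funext => x; exact: mulrC.
Qed.

Lemma gram_mtr : gram mtr = str (gram W).
Proof. by apply/funext => i; apply/funext => j; rewrite /gram pairing_mtr. Qed.

End Transpose.

End MeasureMatrix.

(** * The Geronimus deformation *)

Section Geronimus.
Variable R : realType.
Implicit Types (p Q : {poly R}) (K : set R) (f g h : R -> R) (x : R).

Lemma horner_derivn_root (a : R) (m n : nat) p : (m < n)%N ->
  (p * ('X - a%:P) ^+ n)^`(m).[a] = 0.
Proof.
elim: m n p => [|m IH] [//|n] p mn.
  by rewrite derivn0 exprS mulrCA hornerM hornerXsubC subrr mul0r.
have -> : (p * ('X - a%:P) ^+ n.+1)^`(m.+1) =
    ((p^`() * ('X - a%:P) + p *+ n.+1) * ('X - a%:P) ^+ n)^`(m).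
  rewrite derivSn; congr (derivn _ _).
  rewrite derivM deriv_exp derivXsubC mul1r /=.
  by rewrite [RHS]mulrDl -[X in _ = X + _]mulrA -exprS mulrnAr mulrnAl.
exact: IH.
Qed.

Lemma geronimus_poly_factor (s : nat) (q : 'I_s -> R) (n : 'I_s -> nat) l :
  exists p, geronimus_poly q n = p * ('X - (q l)%:P) ^+ n l.
Proof.
rewrite /geronimus_poly (bigD1 l)//= mulrC; by eexists.
Qed.

Lemma leibniz_geronimus_eq0 (s : nat) (q : 'I_s -> R) (n : 'I_s -> nat) l F m :
  (m < n l)%N -> leibniz (geronimus_poly q n) F m (q l) = 0.
Proof.
move=> mn; have [p ->] := geronimus_poly_factor q n l.
rewrite /leibniz big1// => j _.
by rewrite horner_derivn_root ?mul0rn ?mul0r// (leq_ltn_trans (leq_subr _ _)).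
Qed.

Lemma away_from_zero_geronimus K (s : nat) (q : 'I_s -> R) (n : 'I_s -> nat) :
  closed K -> (forall l, ~ K (q l)) -> away_from_zero K (geronimus_poly q n).
Proof.
move=> cK Kq; rewrite /geronimus_poly; apply: big_ind.
- exact: away_from_zero1.
- by move=> *; exact: away_from_zeroM.
- by move=> l _; apply: away_from_zeroX; exact: away_from_zero_XsubC.
Qed.

Lemma row_finite_calX x : row_finite (calX x).
Proof.
by move=> i; exists i.+2 => k ik; rewrite /calX !gtn_eqF// ltnW.
Qed.

Definition calX_inv Q i k x : R := sinv (speval Q (calX x)) i k.

Lemma calX_invE Q i k x :
  sinv (speval Q (str (calX x))) k i = calX_inv Q i k x.
Proof.
rewrite (str_speval Q (row_finite_calX x)) (sinv_str (speval Q (calX x))).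
exact: erefl.
Qed.

Lemma speval_calX_lower Q x : lower_triangular (str (speval Q (calX x))).
Proof. by move=> i j ij; rewrite /str speval_calX leqNgt ij. Qed.

Lemma speval_calX_diag Q x i : speval Q (calX x) i i = Q.[x].
Proof. by rewrite speval_calX leqnn subnn derivn0 binn. Qed.

(** On rows of derivatives, Leibniz's rule is multiplication by [Q(calX)], which
    is upper triangular with diagonal [Q(x)]. *)
Lemma leibniz_calX_inv Q F x (M k : nat) : Q.[x] != 0 -> (k < M)%N ->
  \sum_(i < M) leibniz Q F i x * calX_inv Q i k x = F k x.
Proof.
move=> Qx kM; pose A := speval Q (calX x).
have lA : lower_triangular (str A) := @speval_calX_lower Q x.
have dA i : str A i i != 0 by rewrite /str /A speval_calX_diag.
have LE (i : 'I_M) : leibniz Q F i x = \sum_(j < M) F j x * A j i.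
  rewrite /leibniz (big_ord_widen M (fun j =>
    (Q^`(i - j).[x] *+ 'C(i, j)) * F j x) (ltn_ord i)) big_mkcond /=.
  apply: eq_bigr => j _; rewrite /A speval_calX ltnS.
  by case: leqP => ji; rewrite ?mulr0// mulrC.
under eq_bigr => i _ do rewrite LE mulr_suml.
rewrite exchange_big /=.
have AV j : \sum_(i < M) A j i * calX_inv Q i k x = (j == k)%:R.
  have /(congr1 (fun B => B k j)) := smul_sinvl lA dA.
  rewrite sdiag1E eq_sym => <-.
  rewrite (@smulr_bound _ _ _ _ _ M); last first.
    by move=> i Mi; rewrite (lower_triangular_sinv lA)// (leq_trans kM).
  by apply: eq_bigr => i _; rewrite (sinv_str A) mulrC.
under eq_bigr => j _.
  under eq_bigr => i _ do rewrite -mulrA.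
  rewrite -mulr_sumr AV; over.
rewrite (bigD1 (Ordinal kM))//= eqxx mulr1 big1 ?addr0// => j jk.
by rewrite (_ : (j == k :> nat) = false) ?mulr0//; exact: negbTE.
Qed.

Lemma tame_eq K f g : measurable_fun setT g -> (forall x, K x -> f x = g x) ->
  tame K f -> tame K g.
Proof.
move=> mg fg [mf [p fp]]; split => //; exists p => x Kx.
by rewrite -fg// fp.
Qed.

(** By Cramer's rule the entries of the inverse are rational functions whose
    denominators are powers of [Q].  At the zeros of [Q], where the block is
    singular, [invmx] returns the block itself, hence a polynomial. *)
Lemma tame_calX_inv K Q i k : away_from_zero K Q -> tame K (calX_inv Q i k).
Proof.
move=> KQ; pose m := maxn i k.
pose P : 'M[{poly R}]_m.+1 := \matrix_(a < m.+1, b < m.+1)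
  (if (a <= b)%N then Q^`(b - a) *+ 'C(b, a) else 0).
have PE x : trunc m.+1 (speval Q (calX x)) = map_mx (horner_eval x) P.
  apply/matrixP => a b; rewrite !mxE speval_calX /horner_eval.
  by case: ifP => _; rewrite ?horner0// hornerMn.
have detP x : \det (map_mx (horner_eval x) P) = (\det P).[x].
  by rewrite det_map_mx.
have dPE : \det P = Q ^+ m.+1.
  rewrite -det_tr det_trig; last first.
    by apply/is_trig_mxP => a b ab; rewrite !mxE leqNgt ab.
  under eq_bigr do rewrite !mxE leqnn subnn binn derivn0.
  by rewrite prodr_const card_ord.
pose c := cofactor P (inord k) (inord i).
have E : calX_inv Q i k = (fun x => if Q.[x] == 0
    then (P (inord i) (inord k)).[x] else rat_eval (c, Q ^+ m.+1) x).
  apply/funext => x; rewrite /calX_inv /sinv -/m PE /invmx unitmxE detP dPE.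
  rewrite unitfE horner_exp expf_eq0 /=; case: eqP => _ /=; first by rewrite mxE.
  by rewrite -map_mx_adj !mxE /rat_eval /= horner_exp mulrC.
have mQ : tame K (rat_eval (c, Q ^+ m.+1)).
  by apply: tame_rat; exact: away_from_zeroX.
apply: tame_eq mQ; rewrite E; last first.
  by move=> x Kx /=; rewrite (negbTE (away_from_zero_neq0 KQ Kx)).
apply: measurable_fun_ifT.
- by apply: measurable_fun_eqr; [exact: measurable_horner|exact: measurable_cst].
- exact: measurable_horner.
apply: measurable_funM; first exact: measurable_horner.
apply: measurableT_comp; first exact: measurable_invr.
exact: measurable_horner.
Qed.

Lemma pad_eq0 (n : nat) (xi : 'M[R]_n) (i j : nat) : (n <= i)%N -> pad xi i j = 0.
Proof.
by move=> ni; rewrite /pad big1// => a /eqP ai; move: (ltn_ord a); rewrite ai ltnNge ni.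
Qed.

Section Left.
Variables (W WL : measure_matrix R) (s : nat) (q : 'I_s -> R) (n : 'I_s -> nat).
Variable xi : forall l : 'I_s, 'M[R]_(n l).
Hypothesis q_notin_Omega : forall l, ~ Omega W (q l).
Hypothesis WL_def : geronimus_left W q xi WL.
Local Notation Q := (geronimus_poly q n).
Local Notation K := [set x | Omega W x \/ exists l, x = q l].

Lemma closed_poles : closed K.
Proof.
have -> : K = Omega W `|` \bigcup_(l in [set: 'I_s]) [set q l].
  apply/seteqP; split => x [Wx|].
  - by left.
  - by move=> [l ->]; right; exists l.
  - by left.
  - by move=> [l _ /= ->]; right; exists l.
apply: closedU; first exact: closed_Omega.
by apply: closed_bigcup => [|l _]; [exact: finite_finset|exact: closed_eq].
Qed.

Lemma sub_poles : Omega W `<=` K.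
Proof. by move=> x; left. Qed.

Lemma away_from_zero_Omega : away_from_zero (Omega W) Q.
Proof. by apply: away_from_zero_geronimus => //; exact: closed_Omega. Qed.

Lemma tame_calX_inv_csupport i k j : tame (csupport (W k j)) (calX_inv Q i k).
Proof.
apply: tame_subset (@csupport_Omega R W k j) _.
by apply: tame_calX_inv; exact: away_from_zero_Omega.
Qed.

(** Off [Omega W] the densities contribute nothing, and off the [q_l] neither do
    the point masses. *)
Lemma csupport_geronimus i j : csupport (WL i j) `<=` K.
Proof.
move=> x; apply: contraPP => Kx /=; rewrite /csupport /= => []; apply.
exists (~` K) => //; split; first by apply: closed_openC; exact: closed_poles.
move=> A mA AK; rewrite WL_def//.
have -> : \sum_(k < (morder W).+1) cintegral (W k j) A (calX_inv Q i k) = 0.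
  rewrite big1// => k _; rewrite -cintegral_indic//.
  have t := tameM (tame_indic (csupport (W k j)) mA) (tame_calX_inv_csupport i k j).
  rewrite -(cintegral_csupport (mentry_poly W k j) t).
  have E : {in csupport (W k j), (fun x => \1_A x * calX_inv Q i k x) =1 (fun=> 0)}.
    move=> y; rewrite inE => /csupport_Omega Wy; rewrite indicE memNset ?mul0r//.
    by move=> /AK; apply; left.
  have mc := @measurable_csupport R (W k j).
  transitivity (cintegral (W k j) (csupport (W k j)) (fun=> 0)).
    by rewrite /cintegral; congr (_ - _); apply: eq_Rintegral; exact: E.
  by rewrite /cintegral !Rintegral_cst// !mul0r subrr.
rewrite add0e /point_masses big1// => l _; rewrite diracE memNset ?mule0//.
by move=> /AK; apply; right; exists l.
Qed.

Lemma Omega_geronimus : Omega WL `<=` K.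
Proof. by move=> x [[i j] _ /=]; exact: csupport_geronimus. Qed.

Lemma cintegral_geronimus i j f : tame K f ->
  cintegral (WL i j) setT f =
  \sum_(k < (morder W).+1)
    cintegral (W k j) setT (fun x => f x * calX_inv Q i k x) +
  \sum_(l < s) pad (xi l) i j * f (q l).
Proof.
move=> tf; apply: (cintegral_density _ _ _ _ _ _ tf).
- exact: mentry_poly.
- by move=> k; exact: mentry_poly.
- exact: csupport_geronimus.
- by move=> k; exact: subset_trans (@csupport_Omega R W k j) sub_poles.
- by move=> k; exact: tame_calX_inv_csupport.
- by move=> A mA; rewrite WL_def.
Qed.

(** By Leibniz's rule the jet of [Q f] is the jet of [f] times [Q(calX)], which
    cancels the density of the deformed matrix.  The mass [xi l] at [q l] only
    sees derivatives of order less than [n l], and these vanish for [Q f]. *)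
Lemma pairing_geronimus f h : smooth K f -> smooth K h ->
  pairing WL (fun x => Q.[x] * f x) h = pairing W f h.
Proof.
move=> [F jF] [H jH]; have jQF := jet_leibniz Q jF.
pose M := (maxn (morder W) (morder WL)).+1.
have WM : (morder W < M)%N by rewrite ltnS leq_maxl.
have WLM : (morder WL < M)%N by rewrite ltnS leq_maxr.
rewrite (pairing_jet Omega_geronimus jQF jH WLM WLM).
rewrite (pairing_jet sub_poles jF jH (ltnSn _) WM).
have [_ tF] := jF; have [_ tH] := jH; have [_ tQF] := jQF.
have WLE (i r : 'I_M) :
    cintegral (WL i r) setT (fun x => leibniz Q F i x * H r x) =
    \sum_(k < (morder W).+1) cintegral (W k r) setT
      (fun x => leibniz Q F i x * H r x * calX_inv Q i k x).
  rewrite cintegral_geronimus; last exact: tameM.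
  rewrite [X in _ + X]big1 ?addr0// => l _.
  have [nl|ln] := leqP (n l) i; first by rewrite pad_eq0 ?mul0r.
  by rewrite leibniz_geronimus_eq0 ?mul0r ?mulr0.
under eq_bigr => i _ do under eq_bigr => r _ do rewrite WLE.
under eq_bigr do rewrite exchange_big /=.
rewrite exchange_big /=; apply: eq_bigr => k _.
rewrite exchange_big /=; apply: eq_bigr => r _.
have KW : csupport (W k r) `<=` K.
  exact: subset_trans (@csupport_Omega R W k r) sub_poles.
have tW g : tame K g -> tame (csupport (W k r)) g by exact: tame_subset.
have tI (i : 'I_M) : tame (csupport (W k r))
    (fun x => leibniz Q F i x * H r x * calX_inv Q i k x).
  by apply: tameM; [apply: tW; exact: tameM|exact: tame_calX_inv_csupport].
rewrite -(cintegral_sum (mentry_poly W k r) _ tI).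
have tS : tame (csupport (W k r)) (fun x => \sum_(i < M)
    leibniz Q F i x * H r x * calX_inv Q i k x) by exact: tame_sum.
have tFH := tW _ (tameM (tF k) (tH r)).
rewrite -(cintegral_csupport (mentry_poly W k r) tS).
rewrite -(cintegral_csupport (mentry_poly W k r) tFH).
have kM : (k < M)%N := leq_trans (ltn_ord k) WM.
have E : {in csupport (W k r), (fun x => \sum_(i < M)
    leibniz Q F i x * H r x * calX_inv Q i k x) =1 (fun x => F k x * H r x)}.
  move=> x; rewrite inE => /csupport_Omega Wx.
  have Qx := away_from_zero_neq0 away_from_zero_Omega Wx.
  under eq_bigr do rewrite mulrAC.
  by rewrite -mulr_suml leibniz_calX_inv.
by rewrite /cintegral; congr (_ - _); apply: eq_Rintegral; exact: E.
Qed.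

(** [pairing_geronimus] for monomials. *)
Lemma gram_geronimus :
  str (gram W) = smul (str (gram WL)) (speval Q (str Defs.shift)).
Proof.
apply/funext => i; apply/funext => j.
have sX m : smooth K (fun x => x ^+ m).
  have := smooth_horner K ('X^m : {poly R}).
  by rewrite (_ : horner 'X^m = fun x => x ^+ m)//; apply/funext => x; rewrite hornerXn.
rewrite -[LHS]/(gram W j i) /gram -pairing_geronimus//.
have -> : (fun x => Q.[x] * x ^+ j) =
    (fun x => \sum_(m < size Q) Q`_m * x ^+ (j + m)).
  apply/funext => x; rewrite horner_coef mulr_suml.
  by apply: eq_bigr => m _; rewrite -mulrA -exprD addnC.
have [_ ->] := pairing_suml (index_enum 'I_(size Q)) (fun m => Q`_m)
  (f := fun m x => x ^+ (j + m)) Omega_geronimus (fun m => sX _) (sX i).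
rewrite (@smull_bound _ _ _ _ _ (j + size Q)); last first.
  move=> k jk; rewrite speval_str_shift; case: ifP => // kj.
  by rewrite nth_default// leq_subRL.
rewrite big_split_ord /= [X in _ = X + _]big1 ?add0r; last first.
  by move=> m _; rewrite speval_str_shift leqNgt ltn_ord mulr0.
by apply: eq_bigr => m _; rewrite speval_str_shift leq_addr addKn mulrC.
Qed.

End Left.
End Geronimus.

(** * Second kind functions *)

Section SecondKind.
Variable R : realType.
Implicit Types (p Q : {poly R}) (K U : set R) (f g : R -> R[i]) (y a : R[i]).
Local Notation Re := (@complex.Re R).
Local Notation Im := (@complex.Im R).

Definition csmooth K f : Prop := smooth K (Re \o f) /\ smooth K (Im \o f).

(** The form of the second kind functions, where one argument is a real
    polynomial; it is complex linear in the other one. *)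
Definition cform (W : measure_matrix R) f p : R[i] :=
  (pairing W (Re \o f) (horner p) +i* pairing W (Im \o f) (horner p))%C.

Lemma Re_lin a f g : Re \o (fun x => a * f x + g x) = fun x =>
  Re a * (Re \o f) x + ((- Im a) * (Im \o f) x + (Re \o g) x).
Proof.
apply/funext => x /=.
by case: a (f x) (g x) => [? ?] [? ?] [? ?] /=; ring.
Qed.

Lemma Im_lin a f g : Im \o (fun x => a * f x + g x) = fun x =>
  Re a * (Im \o f) x + (Im a * (Re \o f) x + (Im \o g) x).
Proof.
apply/funext => x /=.
by case: a (f x) (g x) => [? ?] [? ?] [? ?] /=; ring.
Qed.

Lemma csmooth_lin K a f g : csmooth K f -> csmooth K g ->
  csmooth K (fun x => a * f x + g x).
Proof.
move=> [rf mf] [rg mg]; split.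
  by rewrite Re_lin; do 2?apply: smooth_lin.
by rewrite Im_lin; do 2?apply: smooth_lin.
Qed.

Lemma cform_lin W K a f g p : Omega W `<=` K -> csmooth K f -> csmooth K g ->
  cform W (fun x => a * f x + g x) p = a * cform W f p + cform W g p.
Proof.
move=> WK [rf mf] [rg mg]; have sp := smooth_horner K p.
rewrite /cform Re_lin Im_lin.
rewrite !(pairing_linl _ WK)//; try exact: smooth_lin.
by case: a => a b; apply/eqP; rewrite eq_complex /=; apply/andP; split; apply/eqP; ring.
Qed.

Lemma csmooth0 K : csmooth K (fun=> 0).
Proof. by split; exact: smooth0. Qed.

Lemma cform0 W p : cform W (fun=> 0) p = 0.
Proof. by rewrite /cform !pairing0l//; exact: smooth_horner. Qed.

Lemma cform_sum W K (I : Type) (r : seq I) (c : I -> R[i]) (f : I -> R -> R[i]) p :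
  Omega W `<=` K -> (forall i, csmooth K (f i)) ->
  csmooth K (fun x => \sum_(i <- r) c i * f i x) /\
  cform W (fun x => \sum_(i <- r) c i * f i x) p =
  \sum_(i <- r) c i * cform W (f i) p.
Proof.
move=> WK sf; elim: r => [|i r [sr IH]].
  rewrite big_nil; under eq_fun do rewrite big_nil.
  by split; [exact: csmooth0|exact: cform0].
rewrite big_cons; under eq_fun do rewrite big_cons.
by split; [exact: csmooth_lin|rewrite (cform_lin _ _ WK)// IH].
Qed.

Lemma cform_eq W K U f g p : Omega W `<=` K -> open U -> K `<=` U ->
  (forall x, U x -> f x = g x) -> csmooth K f -> cform W f p = cform W g p.
Proof.
move=> WK oU KU fg [rf mf]; have sp := smooth_horner K p; rewrite /cform.
by congr (_ +i* _)%C; apply: (pairing_eq WK oU KU) => // x /fg /= ->.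
Qed.

Lemma csmooth_real K p : csmooth K (fun x => (p.[x])%:C%C).
Proof. by split; [exact: smooth_horner|exact: smooth0]. Qed.

Lemma cform_real W q p :
  cform W (fun x => (q.[x])%:C%C) p = (pairing W (horner q) (horner p))%:C%C.
Proof.
by rewrite /cform (_ : Im \o _ = fun=> 0) ?pairing0l//; exact: smooth_horner.
Qed.

Lemma cform_sumr W K (N : nat) (c : nat -> R) f (P : nat -> {poly R}) :
  Omega W `<=` K -> csmooth K f ->
  cform W f (\sum_(k < N) (c k)%:P * P k) =
  \sum_(k < N) (c k)%:C%C * cform W f (P k).
Proof.
move=> WK [rf mf].
have H (g : R -> R) : smooth K g -> pairing W g (horner (\sum_(k < N) (c k)%:P * P k)) =
    \sum_(k < N) c k * pairing W g (horner (P k)).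
  move=> sg; have WtK : Omega (mtr W) `<=` K by rewrite Omega_mtr.
  have [_] := pairing_suml (index_enum 'I_N) (fun k => c k)
    (f := fun k => horner (P k)) WtK (fun k => smooth_horner K _) sg.
  rewrite pairing_mtr; under eq_bigr do rewrite pairing_mtr.
  move=> <-; congr (pairing W g); apply/funext => x.
  by rewrite horner_sum; apply: eq_bigr => k _; rewrite hornerM hornerC.
rewrite /cform !H//; elim/big_rec3: _ => // k u v w _ <-.
by apply/eqP; rewrite eq_complex /= !mul0r subr0 addr0 !eqxx.
Qed.

Lemma cpairing_horner W f p : csmooth (Omega W) f ->
  cpairing W f (fun x => (p.[x])%:C%C) = cform W f p.
Proof.
move=> [rf mf]; rewrite /cpairing /cform /=.
have H (g : R -> R) : smooth (Omega W) g -> pairing W g (fun=> 0) = 0.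
  by move=> sg; rewrite -pairing_mtr pairing0l// Omega_mtr.
by rewrite !H// subr0 add0r.
Qed.

Lemma cpairing_mtr W f g : cpairing (mtr W) f g = cpairing W g f.
Proof.
rewrite /cpairing !pairing_mtr; congr (_ +i* _)%C.
exact: addrC.
Qed.

(** The Cauchy kernel is a rational function of a real variable, componentwise,
    with denominator the squared distance to [y]. *)
Lemma csmooth_cauchy K y : closed K -> (forall x, K x -> y <> x%:C%C) ->
  csmooth K (fun x => (y - x%:C%C)^-1).
Proof.
case: y => a b cK Ky; pose d := (a%:P - 'X) ^+ 2 + (b ^+ 2)%:P : {poly R}.
have dE x : d.[x] = (a - x) ^+ 2 + b ^+ 2 by rewrite /d !hornerE.
have Kd : away_from_zero K d.
  have [b0|b0] := eqVneq b 0; last first.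
    exists (b ^+ 2); first by rewrite exprn_even_gt0.
    move=> x _; rewrite dE ger0_norm ?addr_ge0 ?sqr_ge0//.
    by rewrite lerDr sqr_ge0.
  have -> : d = ('X - a%:P) ^+ 2.
    by rewrite /d b0 expr0n /= polyC0 addr0 -sqrrN opprB.
  apply: away_from_zeroX; apply: away_from_zero_XsubC => // Ka.
  by apply: (Ky a Ka); rewrite b0.
split.
  have [F jF] : exists F, jet K (rat_eval (a%:P - 'X, d)) F.
    by eexists; exact: jet_rat.
  exists F; congr jet: jF; apply/funext => x.
  by rewrite /rat_eval /= dE !hornerE subr0.
have [F jF] : exists F, jet K (rat_eval ((- b)%:P, d)) F.
  by eexists; exact: jet_rat.
exists F; congr jet: jF; apply/funext => x.
by rewrite /rat_eval /= dE !hornerE subr0 mulNr.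
Qed.

Lemma second_kind2E W S y l : (forall x, Omega W x -> y <> x%:C%C) ->
  second_kind2 W S y l = cform W (fun x => (y - x%:C%C)^-1) (Ppoly S l).
Proof.
move=> Wy; rewrite /second_kind2 cpairing_horner//.
by apply: csmooth_cauchy => //; exact: closed_Omega.
Qed.

Lemma open_neq_complex y : open [set x : R | y <> x%:C%C].
Proof.
case: y => a b; have [->|b0] := eqVneq b 0; last first.
  rewrite (_ : [set x | _] = setT); first exact: openT.
  by apply/seteqP; split => // x _ /= [_ /eqP]; rewrite (negbTE b0).
rewrite (_ : [set x | _] = ~` [set a]).
  by apply: closed_openC; exact: closed_eq.
apply/seteqP; split => x /= xa.
  by move=> E; apply: xa; rewrite E.
by move=> [E]; apply: xa.
Qed.

End SecondKind.

(** The tails [c_i], the sum over [j] of [p_(i+j) y^j], satisfy Horner's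
    recurrence [c_i = p_i + y c_(i+1)], so that the right-hand side
    telescopes. *)
Lemma horner_divided_difference (A : comNzRingType) (p : {poly A}) (x y : A) :
  p.[y] - p.[x] = (y - x) *
    \sum_(i < size p) (\sum_(j < size p) p`_(i + j).+1 * y ^+ j) * x ^+ i.
Proof.
pose N := size p; pose c i := \sum_(j < N) p`_(i + j) * y ^+ j.
have cS i : c i = p`_i + y * c i.+1.
  rewrite /c; case E: N => [|N'].
    by rewrite !big_ord0 mulr0 addr0 nth_default// -/N E.
  rewrite big_ord_recl [X in y * X]big_ord_recr /= addn0 expr0 mulr1.
  rewrite [p`_(i.+1 + N')]nth_default ?mul0r ?addr0; last first.
    by rewrite -/N E; lia.
  congr (_ + _); rewrite mulr_sumr; apply: eq_bigr => j _.
  by rewrite /bump /= add1n addnS -addSn exprS mulrCA.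
have -> : p.[x] = \sum_(i < N) (c i - y * c i.+1) * x ^+ i.
  by rewrite horner_coef; apply: eq_bigr => i _; rewrite cS addrK.
have -> : p.[y] = c 0%N by rewrite horner_coef.
have cN : c N = 0.
  by rewrite /c big1// => j _; rewrite nth_default ?mul0r// leq_addr.
have := telescope_sumr (fun i => - (c i * x ^+ i)) (leq0n N).
rewrite cN mul0r oppr0 expr0 mulr1 opprK add0r => <-.
rewrite big_mkord mulr_sumr -sumrB; apply: eq_bigr => i _.
under [X in _ = _ * (X * _)]eq_bigr do rewrite -addSn.
by rewrite -/(c i.+1) exprS; ring.
Qed.

(** * Connection formulas *)

Section ConnectionFormulas.
Variable R : realType.

Lemma is_LU_str_smul (G S1 S2 : smatrix R) h : is_LU G S1 h S2 ->
  smul S2 (str G) = smul (sdiag h) (str (sinv S1)).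
Proof.
move=> LU; have := congr1 (@str R) (is_LU_smul_str LU).
by rewrite !str_smul str_diag.
Qed.

Lemma cform_Ppoly (W : measure_matrix R) (S : smatrix R) (i l : nat) :
  lower_triangular S ->
  cform W (fun x => (('X^i : {poly R}).[x])%:C%C) (Ppoly S l) =
  (smul S (str (gram W)) l i)%:C%C.
Proof.
move=> lS; rewrite /Ppoly (@smulv_bound _ _ _ _ l.+1); last first.
  by move=> k lk; rewrite /smap lS ?polyC0.
rewrite (cform_sumr l.+1 (fun k => S l k) (fun k => 'X^k)
  (@subset_refl _ (Omega W)) (csmooth_real _ _)).
rewrite (@smulr_bound _ _ _ _ _ l.+1) => [|k lk]; last exact: lS.
rewrite rmorph_sum; apply: eq_bigr => k _; rewrite rmorphM cform_real.
by congr (_ * (pairing W _ _)%:C%C); apply/funext => x; rewrite hornerXn.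
Qed.

Section Left.
Variables (W WL : measure_matrix R) (s : nat) (q : 'I_s -> R) (n : 'I_s -> nat).
Variable xi : forall l : 'I_s, 'M[R]_(n l).
Hypothesis q_notin_Omega : forall l, ~ Omega W (q l).
Hypothesis WL_def : geronimus_left W q xi WL.
Variables (S1 S2 S1L S2L : smatrix R) (h hL : nat -> R).
Hypothesis LU_W : LU_factorizable (gram W).
Hypothesis W_LU : is_LU (gram W) S1 h S2.
Hypothesis WL_LU : is_LU (gram WL) S1L hL S2L.
Local Notation Q := (geronimus_poly q n).
Local Notation K := [set x | Omega W x \/ exists l, x = q l].
Local Notation omega := (resolvent Q hL S1L S1 h).

Lemma cform_geronimus f p : csmooth K f ->
  cform WL (fun x => (Q.[x])%:C%C * f x) p = cform W f p.
Proof.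
move=> [rf mf]; have sp := smooth_horner K p; rewrite /cform.
rewrite -(pairing_geronimus q_notin_Omega WL_def rf sp).
rewrite -(pairing_geronimus q_notin_Omega WL_def mf sp).
congr (_ +i* _)%C; congr (pairing WL _ _); apply/funext => x /=;
  by case: (f x) => u v /=; rewrite mul0r ?subr0 ?addr0.
Qed.

Lemma connection_resolvent : omega = smul S2L (sinv S2).
Proof.
apply: (resolventE W_LU WL_LU); first exact: is_LU_diag_neq0 LU_W W_LU.
exact: gram_geronimus q_notin_Omega WL_def.
Qed.

Lemma row_finite_connection : row_finite omega.
Proof.
have [_ u2 _] := W_LU; have [_ u2L _] := WL_LU.
rewrite connection_resolvent; apply: row_finite_smul; apply: row_finite_lower.
  exact: unitriangular_lower.
exact: unitriangular_sinv_lower.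
Qed.

Lemma connection_Ppoly : smulv (smap polyC omega) (Ppoly S2) = Ppoly S2L.
Proof.
have [_ u2 _] := W_LU; have [_ u2L _] := WL_LU.
have l2 := unitriangular_lower u2; have d2 := unitriangular_diag u2.
have r2L := row_finite_lower (unitriangular_lower u2L).
have rV := row_finite_lower (unitriangular_sinv_lower u2).
rewrite /Ppoly smulvA; last 2 first.
- exact: row_finite_smap row_finite_connection.
- exact: row_finite_smap (row_finite_lower l2).
rewrite -(smap_smul polyC S2 row_finite_connection) connection_resolvent.
by rewrite -smulA_rr// smul_sinvl// smuls1.
Qed.

(** Since [omega] connects the polynomials, [omega C2] pairs the Cauchy kernel
    with [Ppoly S2L] for [W], hence [Q] times the kernel for [WL].  The divided
    difference of [Q] then splits off the Hankel term. *)
Lemma connection_second_kind (y : R[i]) :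
  (forall x, K x -> y <> x%:C%C) -> forall l,
  smulv (smap (real_complex R) omega) (second_kind2 W S2 y) l =
  (map_poly (real_complex R) Q).[y] * second_kind2 WL S2L y l
  - smulv (smap (real_complex R)
      (smul (smul (sdiag hL) (str (sinv S1L))) (Qhankel Q))) (schi y) l.
Proof.
move=> Ky l.
have WK : Omega W `<=` K := @sub_poles R W s q.
have WLK : Omega WL `<=` K := Omega_geronimus q_notin_Omega WL_def.
have cK : closed K := @closed_poles R W s q.
pose kappa (x : R) : R[i] := (y - x%:C%C)^-1.
have sk : csmooth K kappa := csmooth_cauchy cK Ky.
have [N HN] := row_finite_connection l.
have -> : smulv (smap (real_complex R) omega) (second_kind2 W S2 y) l =
    cform W kappa (Ppoly S2L l).
  rewrite -connection_Ppoly (@smulv_bound _ _ _ _ N); last first.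
    by move=> k /HN; rewrite /smap => ->.
  rewrite (@smulv_bound _ _ _ _ N); last first.
    by move=> k /HN; rewrite /smap => ->.
  rewrite (cform_sumr N (fun k => omega l k) (Ppoly S2) WK sk).
  apply: eq_bigr => k _; rewrite second_kind2E// => x Wx.
  by apply: Ky; left.
rewrite second_kind2E; last by move=> x /WLK; exact: Ky.
rewrite -/kappa -(cform_geronimus _ sk).
pose Qc := map_poly (real_complex R) Q; pose M := size Q.
pose c i := \sum_(j < M) (Q`_(i + j).+1)%:C%C * y ^+ j.
have oU := @open_neq_complex R y.
have KU : K `<=` [set x : R | y <> x%:C%C] by move=> x Kx; exact: Ky.
have sX i : csmooth K (fun x => (('X^i : {poly R}).[x])%:C%C).
  exact: csmooth_real.
have [sS fS] := cform_sum (index_enum 'I_M) (fun i : 'I_M => - c i)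
  (f := fun i x => (('X^i : {poly R}).[x])%:C%C) (Ppoly S2L l) WLK (fun i => sX i).
(* [Q(x) / (y - x) = Q(y) / (y - x) - sum_i c_i x^i], valid off [x = y] only *)
rewrite -(cform_eq (f := fun x => Qc.[y] * kappa x +
   \sum_(i < M) - c i * (('X^i : {poly R}).[x])%:C%C) _ WLK oU KU); last 2 first.
- move=> x /= yx; have yx0 : y - x%:C%C != 0 by rewrite subr_eq0; exact/eqP.
  have -> : (Q.[x])%:C%C = Qc.[x%:C%C] by rewrite horner_map.
  have := horner_divided_difference Qc x%:C%C y.
  rewrite size_map_poly -/M => /eqP; rewrite subr_eq => /eqP ->.
  rewrite mulrDl [_ * _ * kappa x]mulrC {1}/kappa mulKf// addrAC -[RHS]add0r; congr (_ + _).
  rewrite -big_split big1//= => i _; rewrite hornerXn rmorphXn /= -mulrDl.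
  rewrite [X in X * _](_ : _ = 0) ?mul0r//; apply/eqP; rewrite subr_eq0; apply/eqP.
  by apply: eq_bigr => j _; rewrite coef_map.
- exact: csmooth_lin.
rewrite (cform_lin _ _ WLK sk sS) fS; congr (_ + _).
have [_ u2L _] := WL_LU.
have l2L := unitriangular_lower u2L.
under eq_bigr => i _ do rewrite (cform_Ppoly _ _ _ l2L) (is_LU_str_smul WL_LU).
set U := smul (sdiag hL) _.
have HQ i j : (M <= i + j)%N -> Qhankel Q i j = 0.
  by move=> Mij; rewrite /Qhankel nth_default// ltnW.
have UQ j : smul U (Qhankel Q) l j = \sum_(i < M) U l i * Qhankel Q i j.
  apply: smull_bound => i Mi; apply: HQ; exact: leq_trans (leq_addr _ _).
rewrite (@smulv_bound _ _ _ _ M); last first.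
  move=> j Mj; rewrite /smap UQ big1 ?rmorph0// => i _.
  by rewrite HQ ?mulr0// (leq_trans Mj)// leq_addl.
under eq_bigr do rewrite mulNr mulr_suml.
rewrite sumrN exchange_big /=; congr (- _); apply: eq_bigr => j _.
rewrite /smap UQ rmorph_sum mulr_suml; apply: eq_bigr => i _.
by rewrite rmorphM /schi mulrAC [X in X * _]mulrC.
Qed.

End Left.
End ConnectionFormulas.

Theorem proposition21 (R : realType) (W WL WR : measure_matrix R)
    (s : nat) (q : 'I_s -> R) (n : 'I_s -> nat)
    (xiL xiR : forall l : 'I_s, 'M[R]_(n l))
    (S1 S2 S1L S2L S1R S2R : smatrix R) (h hL hR : nat -> R)
    (Q := geronimus_poly q n)
    (omegaL := resolvent Q hL S1L S1 h)
    (omegaR := resolvent Q hR S2R S2 h)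
    (q_notin_Omega : forall l, ~ Omega W (q l))
    (WL_def : geronimus_left W q xiL WL)
    (WR_def : geronimus_right W q xiR WR)
    (LU_W : LU_factorizable (gram W))
    (LU_WL : LU_factorizable (gram WL))
    (LU_WR : LU_factorizable (gram WR))
    (W_LU : is_LU (gram W) S1 h S2)
    (WL_LU : is_LU (gram WL) S1L hL S2L)
    (WR_LU : is_LU (gram WR) S1R hR S2R) :
  [/\ smulv (smap polyC omegaL) (Ppoly S2) = Ppoly S2L,
      forall y : R[i],
        (forall x : R, Omega W x \/ (exists l, x = q l) -> y <> x%:C%C) ->
        forall l : nat,
          smulv (smap (real_complex R) omegaL) (second_kind2 W S2 y) l =
          (map_poly (real_complex R) Q).[y] * second_kind2 WL S2L y l
          - smulv (smap (real_complex R)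
                     (smul (smul (sdiag hL) (str (sinv S1L))) (Qhankel Q)))
                  (schi y) l,
      smulv (smap polyC omegaR) (Ppoly S1) = Ppoly S1R
    & forall y : R[i],
        (forall x : R, Omega W x \/ (exists l, x = q l) -> y <> x%:C%C) ->
        forall l : nat,
          smulv (smap (real_complex R) omegaR) (second_kind1 W S1 y) l =
          (map_poly (real_complex R) Q).[y] * second_kind1 WR S1R y l
          - smulv (smap (real_complex R)
                     (smul (smul (sdiag hR) (str (sinv S2R))) (Qhankel Q)))
                  (schi y) l].
Proof.
have right_mtr : geronimus_left (mtr W) q (fun l => (xiR l)^T) (mtr WR).
  move=> i j A mA; rewrite /= WR_def//; congr ((_)%:E + _)%E.
    by apply: eq_bigr => k _; congr cintegral; apply/funext => x; exact: calX_invE.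
  apply: eq_bigr => l _; congr ((_)%:E * _)%E; rewrite /pad exchange_big /=.
  by apply: eq_bigr => a _; apply: eq_bigr => b _; rewrite mxE.
have q_notin l : ~ Omega (mtr W) (q l) by rewrite Omega_mtr.
have mtr_LU_W : LU_factorizable (gram (mtr W)).
  move=> k k0; rewrite gram_mtr -det_tr.
  by rewrite (_ : (trunc k _)^T = trunc k (gram W)) ?LU_W//; apply/matrixP => i j; rewrite !mxE.
have W_mtr : is_LU (gram (mtr W)) S2 h S1 by rewrite gram_mtr; exact: is_LU_str.
have WR_mtr : is_LU (gram (mtr WR)) S2R hR S1R by rewrite gram_mtr; exact: is_LU_str.
have second_mtr (V : measure_matrix R) S y : second_kind1 V S y = second_kind2 (mtr V) S y.
  by apply/funext => l; rewrite /second_kind2 cpairing_mtr.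
rewrite {}/omegaL {}/omegaR {}/Q; split.
- exact (connection_Ppoly q_notin_Omega WL_def LU_W W_LU WL_LU).
- exact (connection_second_kind q_notin_Omega WL_def LU_W W_LU WL_LU).
- exact (connection_Ppoly q_notin right_mtr mtr_LU_W W_mtr WR_mtr).
- move=> y; rewrite -(Omega_mtr W) => Ky l; rewrite !second_mtr.
  exact (connection_second_kind q_notin right_mtr mtr_LU_W W_mtr WR_mtr Ky l).
Qed.
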